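(* Let $Q=(Q_0,Q_1)$ be a quiver without oriented loops (no oriented cycles), with vertex set $Q_0=\{1,\dots,n\}$, and let $e=(e_1,\dots,e_n)\in\mathbb{N}^n$ be a dimension vector. Then every element of $\mathcal{R}(\mathbb{G})$ can be expressed uniquely as a (possibly infinite) $\mathbb{Z}$-linear combination of products $$\mathcal{G}_{\mu_1}(E_1-M_1)\,\mathcal{G}_{\mu_2}(E_2-M_2)\cdots\mathcal{G}_{\mu_n}(E_n-M_n)$$ given by partitions $\mu_1,\dots,\mu_n$ such that $\ell(\mu_i)\le e_i$ for each $i$.
   Context: Quivers: each arrow $a\in Q_1$ (finite set) has a tail $t(a)$ and head $h(a)$ in $Q_0$. Over a field $\mathbb{K}$ set $E_i=\mathbb{K}^{e_i}$, $\mathbb{G}=\mathrm{GL}(E_1)\times\dots\times\mathrm{GL}(E_n)$, and $M_i=\bigoplus_{a:h(a)=i}E_{t(a)}$ (with multiplicity if there are several arrows from a vertex to $i$). $\mathcal{R}(\mathbb{G})$ is the ring of virtual rational representations of $\mathbb{G}$ (representation ring; product is tensor product). Power series: write $E_i=L^i_1\oplus\dots\oplus L^i_{e_i}$ as a sum of lines and let $\mathbb{T}\subset\mathbb{G}$ be the maximal torus preserving these decompositions. Then $\mathcal{R}(\mathbb{T})=\mathbb{Z}[[L^i_j]^{\pm1}]$, $\mathcal{R}(\mathbb{G})\subset\mathcal{R}(\mathbb{T})$ is the subring of Laurent polynomials symmetric in each group $[L^i_1],\dots,[L^i_{e_i}]$, and with $x^i_j=1-[L^i_j]^{-1}$ we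 regard $\mathcal{R}(\mathbb{T})$ as a subring of the power series ring $\mathbb{Z}[[x^i_j: 1\le i\le n,\,1\le j\le e_i]]$ via $[L^i_j]=\sum_{p\ge0}(x^i_j)^p$. Infinite linear combinations are taken in this power series ring. Grothendieck polynomials: partitions $\lambda$ are identified with Young diagrams, $|\lambda|$ is the sum of the parts, $\ell(\lambda)$ the number of non-zero parts, $\lambda'$ the conjugate partition. A set-valued tableau $T$ of shape $\lambda$ is a filling of the boxes of $\lambda$ with finite non-empty sets of positive integers such that the largest integer in any box is at most the smallest integer in the box to its right and strictly smaller than the smallest integer in the box below it. Let $x^T$ be the monomial in which the exponent of $x_i$ is the number of boxes containing $i$, and $|T|=\deg x^T$. Put $\mathcal{G}_\lambda=\mathcal{G}_\lambda(x)=\sum_T(-1)^{|T|-|\lambda|}x^T$, the sum over all set-valued tableaux of shape $\lambda$ (a symmetric power series), and $\mathcal{G}_\lambda(x_1,\dots,x_p)=\mathcal{G}_\lambda(x_1,\dots,x_p,0,0,\dots)$. The $\mathcal{G}_\lambda$ are linearly independent and their span $\Gamma=\bigoplus_\lambda\mathbb{Z}\mathcal{G}_\lambda$ is a ring; define $c^\nu_{\lambda\mu}$ by $\mathcal{G}_\lambda\mathcal{G}_\mu=\sum_\nu c^\nu_{\lambda\mu}\mathcal{G}_\nu$. Define $d^\nu_{\lambda\mu}=c^\rho_{R\nu}$, where $R=(q^p)$ is any rectangle ($p$ rows, $q$ columns) containing $\lambda$ and $\mu$ and $\rho=(q+\mu_1,\dots,q+\mu_p,\lambda_1,\lambda_2,\dots)$;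 this is independent of $R$. For a rational $\mathbb{G}$-representation $U$, decomposed under $\mathbb{T}$ as $U=L_1\oplus\dots\oplus L_u$ with $\dim L_j=1$, put $\mathcal{G}_\nu(U)=\mathcal{G}_\nu(1-[L_1]^{-1},\dots,1-[L_u]^{-1})\in\mathcal{R}(\mathbb{G})$, and for two rational representations put $\mathcal{G}_\nu(U_1-U_2)=\sum_{\lambda,\mu}d^\nu_{\lambda\mu}\,\mathcal{G}_\lambda(U_1)\,\mathcal{G}_{\mu'}(U_2^\vee)\in\mathcal{R}(\mathbb{G})$. *)

(* Defs.v *)
From HB Require Import structures.
From mathcomp Require Import all_boot all_order all_algebra perm.
From mathcomp Require Import finmap multiset.
From mathcomp Require Import boolp classical_sets functions cardinality fsbigop.

Set Implicit Arguments.
Unset Strict Implicit.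
Unset Printing Implicit Defensive.

Import GRing.Theory.

Local Open Scope mset_scope.
Local Open Scope classical_set_scope.
Local Open Scope ring_scope.

(** * Formal power series over Z in a (possibly infinite) family of variables *)

(* The multiset m stands for the monomial \prod_k X_k ^ (m k), and a series is
   its function of coefficients. *)
Definition mseries (I : choiceType) : Type := {mset I} -> int.

HB.instance Definition _ (I : choiceType) :=
  GRing.Zmodule.copy (mseries I) ({mset I} -> int).

Section Mseries.
Variable I : choiceType.
Implicit Types (m : {mset I}) (f g h : mseries I).

Definition splits m : set ({mset I} * {mset I}) :=
  [set p | (p.1 `+` p.2)%mset = m].

Definition mseries_one : mseries I := fun m => (m == mset0)%:R.
Definition mseries_mul f g : mseries I :=
  fun m => \sum_(p \in splits m) f p.1 * g p.2.

Lemma finite_splits m : finite_set (splits m).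
Proof.
pose F (b : (size m).-tuple bool * (size m).-tuple bool) :=
  (seq_mset (mask b.1 m), seq_mset (mask b.2 m)).
have sub_mask (a : {mset I}) : (forall x, a x <= m x)%N ->
    exists b : (size m).-tuple bool, seq_mset (mask b m) = a.
  move=> le_am; have /count_subseqP[s /subseqP[b sz_b ->] eq_as] :
    forall x, (count_mem x a <= count_mem x m)%N by move=> x; rewrite !count_mem_mset.
  exists (tcast sz_b (in_tuple b)); rewrite val_tcast/=.
  by rewrite -[RHS]seq_mset_id; apply/eq_seq_msetP; rewrite perm_sym.
apply: (@sub_finite_set _ _ (F @` setT)); last first.
  exact/finite_image/finite_finset.
move=> [a b] /= ab_m.
have [|u ua] := sub_mask a; first by move=> x; rewrite -ab_m msetE2 leq_addr.
have [|v vb] := sub_mask b; first by move=> x; rewrite -ab_m msetE2 leq_addl.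
by exists (u, v); rewrite // /F/= ua vb.
Qed.

Let D m : seq ({mset I} * {mset I}) := fset_set (splits m).

Let mem_D m p : (p \in D m) = ((p.1 `+` p.2)%mset == m).
Proof.
rewrite /D in_fset_set; last exact: finite_splits.
by apply/idP/eqP; rewrite inE.
Qed.

Let D_uniq m : uniq (D m). Proof. exact: fset_uniq. Qed.

Lemma mseries_mulE f g m : mseries_mul f g m = \sum_(p <- D m) f p.1 * g p.2.
Proof. by rewrite /mseries_mul fsbig_finite//; exact: finite_splits. Qed.

Fact mseries_mulC : commutative mseries_mul.
Proof.
move=> f g; apply/funext => m; rewrite !mseries_mulE.
have sw : perm_eq (D m) [seq (p.2, p.1) | p <- D m].
  apply: uniq_perm => //; first by rewrite map_inj_uniq// => -[? ?] [? ?] [-> ->].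
  move=> [a b]; rewrite mem_D; apply/eqP/mapP => [abm|[[c d] + [-> ->]]] /=.
    by exists (b, a); rewrite // mem_D/= msetDC; apply/eqP.
  by rewrite mem_D/= msetDC => /eqP.
by rewrite (perm_big _ sw) big_map; apply: eq_bigr => p _; rewrite mulrC.
Qed.

Fact mseries_mulA : associative mseries_mul.
Proof.
move=> f g h; apply/funext => m; rewrite !mseries_mulE.
pose T := ({mset I} * {mset I} * {mset I})%type.
pose F (t : T) := f t.1.1 * g t.1.2 * h t.2.
pose s1 : seq T := [seq (p.1, q.1, q.2) | p <- D m, q <- D p.2].
pose s2 : seq T := [seq (q.1, q.2, p.2) | p <- D m, q <- D p.1].
transitivity (\sum_(t <- s1) F t).
  rewrite big_allpairs_dep; apply: eq_bigr => p _.
  by rewrite mseries_mulE mulr_sumr; apply: eq_bigr => q _; rewrite mulrA.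
transitivity (\sum_(t <- s2) F t); last first.
  rewrite big_allpairs_dep; apply: eq_bigr => p _.
  by rewrite mseries_mulE mulr_suml.
apply: perm_big; apply: uniq_perm.
- apply: allpairs_uniq_dep => // -[p q] [p' q'].
  move=> /allpairsPdep[[a b] [[c d] [_ + eqpq]]].
  move=> /[swap] /allpairsPdep[[a' b'] [[c' d'] [_ + eqpq']]].
  move: eqpq eqpq' => [-> ->] [-> ->].
  by rewrite !mem_D/= => /eqP <- /eqP <- [-> -> ->].
- apply: allpairs_uniq_dep => // -[p q] [p' q'].
  move=> /allpairsPdep[[a b] [[c d] [_ + eqpq]]].
  move=> /[swap] /allpairsPdep[[a' b'] [[c' d'] [_ + eqpq']]].
  move: eqpq eqpq' => [-> ->] [-> ->].
  by rewrite !mem_D/= => /eqP <- /eqP <- [-> -> ->].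
- move=> [[a b] c]; apply/allpairsPdep/allpairsPdep => -[[u v] [[w x] []]];
    rewrite !mem_D/= => /eqP <- /eqP <- [-> -> ->].
    by exists ((u `+` w)%mset, x), (u, w); rewrite !mem_D/= msetDA !eqxx.
  by exists (w, (x `+` v)%mset), (x, v); rewrite !mem_D/= msetDA !eqxx.
Qed.

Fact mseries_mul1 : left_id mseries_one mseries_mul.
Proof.
move=> f; apply/funext => m; rewrite mseries_mulE.
rewrite (bigD1_seq (mset0, m))/= ?mem_D ?mset0D// /mseries_one eqxx mul1r.
rewrite big_seq_cond big1 ?addr0// => -[a b] /andP[]; rewrite mem_D/= => /eqP <-.
move=> ab_neq; case: eqP => [a0|_]; last by rewrite mul0r.
by rewrite a0 mset0D eqxx in ab_neq.
Qed.

Fact mseries_mulDl : left_distributive mseries_mul +%R.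
Proof.
move=> f g h; apply/funext => m.
rewrite [RHS](_ : _ = mseries_mul f h m + mseries_mul g h m)// !mseries_mulE -big_split/=.
by apply: eq_bigr => p _; rewrite -mulrDl.
Qed.

Fact mseries_1neq0 : mseries_one != 0 :> mseries I.
Proof. by apply/eqP => /(congr1 (@^~ mset0)); rewrite /mseries_one eqxx. Qed.

HB.instance Definition _ := GRing.Zmodule_isComNzRing.Build (mseries I)
  mseries_mulA mseries_mulC mseries_mul1 mseries_mulDl mseries_1neq0.

Definition mvar (k : I) : mseries I := fun m => (m == [mset k]%mset)%:R.

(* Infinite sums are coefficientwise; mseries_sum is only meaningful for
   summable families, i.e. when each monomial occurs in finitely many terms. *)
Definition summable (J : choiceType) (A : set J) (F : J -> mseries I) : Prop :=
  forall m, finite_set [set j | A j /\ F j m != 0].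

Definition mseries_sum (J : choiceType) (A : set J) (F : J -> mseries I) :
  mseries I := fun m => \sum_(j \in A) F j m.

Definition sums_to (J : choiceType) (A : set J) (F : J -> mseries I) f : Prop :=
  summable A F /\ mseries_sum A F = f.

End Mseries.

(** * Partitions *)

Definition is_intpart (s : seq nat) : bool := sorted geq s && (0 \notin s)%N.

Record intpart := IntPart {
  parts :> seq nat;
  partsP : is_intpart parts }.

HB.instance Definition _ := [isSub for parts].
HB.instance Definition _ := [Choice of intpart by <:].

Definition conj_seq (la : seq nat) : seq nat :=
  mkseq (fun j => count (fun x => j < x)%N la) (head 0%N la).

Fact conj_is_intpart (la : intpart) : is_intpart (conj_seq la).
Proof.
case: la => -[|x s] //= /andP[srt n0]; apply/andP; split; last first.
  apply/mapP => -[j]; rewrite mem_iota add0n => /andP[_ jx] /esym/eqP.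
  by rewrite /= jx.
rewrite /conj_seq /mkseq sorted_map; apply: sub_sorted (iota_sorted _ _).
by move=> i j ij; apply: sub_count => y; apply: leq_ltn_trans.
Qed.

Definition conj_part (la : intpart) : intpart :=
  IntPart (conj_is_intpart la).

(* With p = rect_rows and q = rect_cols, R = (q^p) is the smallest rectangle
   containing la and mu, and rho = (q + mu_1, ..., q + mu_p, la_1, la_2, ...).
   The coefficient c^rho_{R nu} is the same for all rectangles containing la
   and mu, so using the smallest one in groth_d below is no restriction. *)
Section Rectangle.
Variables la mu : intpart.

Definition rect_rows : nat := maxn (size la) (size mu).
Definition rect_cols : nat := maxn (head 0%N la) (head 0%N mu).
Definition rect_seq : seq nat := nseq rect_rows rect_cols.
Definition rho_seq : seq nat :=
  mkseq (fun i => rect_cols + nth 0 mu i)%N rect_rows ++ la.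

Let head_gt0 (nu : intpart) : (0 < size nu -> 0 < head 0 nu)%N.
Proof. by case: nu => -[|[|x] s]//= /andP[_]; rewrite inE. Qed.

Let cols_gt0 : (0 < rect_rows -> 0 < rect_cols)%N.
Proof.
by rewrite /rect_rows /rect_cols !leq_max => /orP[] /head_gt0 ->; rewrite ?orbT.
Qed.

Let geq_trans : transitive geq.
Proof. by move=> y x z /= yx zy; apply: leq_trans zy yx. Qed.

Fact rect_is_intpart : is_intpart rect_seq.
Proof.
apply/andP; split; last first.
  by rewrite mem_nseq negb_and; case: rect_rows cols_gt0 => //= p /(_ isT); rewrite lt0n eq_sym.
rewrite /rect_seq; case: rect_rows => //= p.
by elim: p => //= p ->; rewrite leqnn.
Qed.

Let nth_mu i j : (i <= j -> nth 0 mu j <= nth 0 mu i)%N.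
Proof.
move=> ij; have [jm|jm] := ltnP j (size mu); last by rewrite nth_default.
case: mu jm => s /= /andP[srt _] jm.
by apply: (sorted_leq_nth geq_trans leqnn) => //; rewrite inE (leq_ltn_trans ij).
Qed.

Fact rho_is_intpart : is_intpart rho_seq.
Proof.
have la_le x : x \in (la : seq nat) -> (x <= rect_cols)%N.
  move=> xla; apply: leq_trans (leq_maxl _ _).
  case: la xla => -[|y s] //= /andP[srt _]; rewrite inE => /predU1P[->//|].
  by have /allP := order_path_min geq_trans srt; apply.
apply/andP; split; last first.
  rewrite mem_cat negb_or; case/andP: (partsP la) => _ ->; rewrite andbT.
  apply/mapP => -[i]; rewrite mem_iota => /andP[_ ip] /esym/eqP.
  rewrite addn_eq0 -leqn0 leqNgt cols_gt0//; exact: leq_ltn_trans ip.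
rewrite (sorted_pairwise geq_trans) pairwise_cat -!(sorted_pairwise geq_trans).
apply/and3P; split; last by case/andP: (partsP la).
  apply/allrelP => x y /mapP[i _ ->] /la_le yq /=.
  exact: leq_trans yq (leq_addr _ _).
rewrite sorted_map; apply: sub_sorted (iota_sorted _ _) => i j ij /=.
by rewrite leq_add2l; apply: nth_mu.
Qed.

Definition rect_part : intpart := IntPart rect_is_intpart.
Definition rho_part : intpart := IntPart rho_is_intpart.

End Rectangle.

(** * Grothendieck polynomials *)

Definition box (la : intpart) : finType :=
  {r : 'I_(size la) & 'I_(nth 0%N la r)}.
Definition box_row (la : intpart) (b : box la) : nat := tag b.
Definition box_col (la : intpart) (b : box la) : nat := tagged b.

(* The index k : nat stands for the positive integer k + 1, so that mvar 0,
   mvar 1, ... are the variables x_1, x_2, ... *)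
Definition filling (la : intpart) : Type := {ffun box la -> {fset nat}}.
HB.instance Definition _ (la : intpart) := Choice.on (filling la).

Definition set_valued_tableau (la : intpart) (T : filling la) : Prop :=
  [/\ forall b, T b != fset0,
      forall b b', box_row b' = box_row b -> box_col b' = (box_col b).+1 ->
        forall x y, x \in T b -> y \in T b' -> (x <= y)%N
    & forall b b', box_row b' = (box_row b).+1 -> box_col b' = box_col b ->
        forall x y, x \in T b -> y \in T b' -> (x < y)%N].

Definition filling_size (la : intpart) (T : filling la) : nat :=
  (\sum_b #|` T b|)%N.

(* G_la with the series a 0, a 1, ... substituted for x_1, x_2, ... *)
Definition groth (I : choiceType) (la : intpart) (a : nat -> mseries I) :
  mseries I :=
  mseries_sum (@set_valued_tableau la) (fun T =>
    (-1) ^+ (filling_size T - sumn la) * \prod_b \prod_(k <- T b) a k).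

Definition Groth (la : intpart) : mseries nat := groth la (@mvar nat).

(* c^nu_{la mu}: the lowest-degree form of Groth nu being a Schur function, the
   coefficients of an expansion in the Groth nu are unique, even if infinite
   expansions are allowed; so this is the expansion in \Gamma. *)
Definition groth_c (la mu : intpart) : intpart -> int :=
  xget (fun=> 0) [set c : intpart -> int |
    sums_to setT (fun nu => Groth nu *~ c nu) (Groth la * Groth mu)].

Definition groth_d (nu la mu : intpart) : int :=
  groth_c (rect_part la mu) nu (rho_part la mu).

(** * Representations *)

(* A weight w : {ffun I -> int} is the character \prod_k L_k ^ (w k) of the
   torus with coordinate lines L_k, and a representation is given by the list
   of the lines into which it decomposes. *)
Section Torus.
Variable I : finType.

Definition line (k : I) : {ffun I -> int} := [ffun l => (l == k)%:Z].

Definition dual_rep (U : seq {ffun I -> int}) : seq {ffun I -> int} :=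
  [seq - w | w <- U].

(* [L_k] = \sum_p X_k ^ p, where X_k = 1 - [L_k]^-1. *)
Definition class_line (k : I) : mseries I :=
  mseries_sum [set: nat] (fun p => mvar k ^+ p).

Definition class_line_exp (k : I) (z : int) : mseries I :=
  match z with
  | Posz p => class_line k ^+ p
  | Negz p => (1 - mvar k) ^+ p.+1
  end.

Definition weight_class (w : {ffun I -> int}) : mseries I :=
  \prod_k class_line_exp k (w k).

(* R(T), the Laurent polynomials in the [L_k], by their coefficients. *)
Definition laurent : Type := {fsfun {ffun I -> int} -> int with 0}.

Definition laurent_mseries (P : laurent) : mseries I :=
  \sum_(w <- finsupp P) weight_class w *~ P w.

Definition grothU (nu : intpart) (U : seq {ffun I -> int}) : mseries I :=
  groth nu (fun k => [seq 1 - weight_class (- w) | w <- U]`_k).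

(* G_nu(U1 - U2) *)
Definition grothB (nu : intpart) (U1 U2 : seq {ffun I -> int}) : mseries I :=
  mseries_sum [set: intpart * intpart] (fun p =>
    grothU p.1 U1 * grothU (conj_part p.2) (dual_rep U2) *~ groth_d nu p.1 p.2).

End Torus.

(** * Quivers *)

Record quiver (n : nat) := Quiver {
  arrow : finType;
  qtail : arrow -> 'I_n;
  qhead : arrow -> 'I_n }.

Definition adjacent n (Q : quiver n) : rel 'I_n :=
  fun i j => [exists a : arrow Q, (qtail a == i) && (qhead a == j)].

Definition acyclic n (Q : quiver n) : Prop :=
  forall s : seq 'I_n, cycle (adjacent Q) s -> s = [::].

Section QuiverRep.
Variables (n : nat) (e : 'I_n -> nat).

Definition torus_coord : finType := {i : 'I_n & 'I_(e i)}.

Definition permute (s : forall i, {perm 'I_(e i)}) (w : {ffun torus_coord -> int}) :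
  {ffun torus_coord -> int} :=
  [ffun k => w (Tagged (fun i => 'I_(e i)) (s (tag k) (tagged k)))].

Definition symmetric_laurent (P : laurent torus_coord) : Prop :=
  forall s w, P (permute s w) = P w.

Definition repE (i : 'I_n) : seq {ffun torus_coord -> int} :=
  [seq line (Tagged (fun i => 'I_(e i)) j) | j <- enum 'I_(e i)].

Definition repM (Q : quiver n) (i : 'I_n) : seq {ffun torus_coord -> int} :=
  flatten [seq repE (qtail a) | a <- enum (arrow Q) & qhead a == i].

(* R(G): the Laurent polynomials that, for each i, are symmetric in the lines
   of E_i, regarded as power series. *)
Definition rep_ring : set (mseries torus_coord) :=
  [set laurent_mseries P | P in symmetric_laurent].

Definition bounded_parts : choiceType :=
  {mu : {ffun 'I_n -> intpart} | [forall i, (size (mu i) <= e i)%N]}.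

End QuiverRep.

(* Main.v *)
Require Import Defs.
From mathcomp Require Import all_boot all_order all_algebra perm.
From mathcomp Require Import finmap multiset.
From mathcomp Require Import boolp classical_sets functions cardinality fsbigop.
From mathcomp Require Import zify ring.
From mathcomp Require mpoly.
Import (canonicals) mpoly.

(** Elements of the representation ring are power series that are symmetric in
    the variables of each E_i, and so are the products of the G_(mu_i)(E_i - M_i).
    Such a series is determined by its coefficients at the monomials x^mu in which
    the exponents of the variables of E_i are the parts of a partition mu_i with
    at most e_i parts.  It is therefore enough to show that the product indexed by
    mu has leading monomial x^mu, with coefficient 1, for an order on monomials in
    which only finitely many x^mu lie below a given one: existence and uniqueness
    of the coefficients then follow by recursion (triangular_expansion).

    The order compares weights.  A variable of E_i has as its weight the height of
    the vertex i, the number of vertices reachable from it.  As the quiver has no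
    oriented cycles, heights decrease along arrows, and all variables of M_i weigh
    more than those of E_i.  Now G_nu(E_i - M_i) is a sum of terms
    d^nu_(la,mu) G_la(E_i) G_(mu')(M_i^dual), and a Grothendieck polynomial has no
    terms of degree less than the size of its partition.  If d^nu_(la,mu) is 0
    unless |nu| <= |la| + |mu| (groth_d_small), then the terms of least weight
    have mu empty and |la| = |nu|; and if d^nu_(la,0) is 1 for la = nu and 0 for
    other la of that size (groth_d_delta), only G_nu(E_i) is left (grothB_lead).
    Monomials of equal weight are separated by the sum of the indices of their
    variables: in a tableau an entry is at least the index of its row, so this sum
    is minimal for the tableau with r in all boxes of row r, whose monomial is
    x^nu (groth_lead).

    Two facts on Grothendieck polynomials remain.  They are symmetric: this
    follows from the bialternant formula (bialternant), which presents G_la in N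
    variables as the quotient of det (x_i^(la_j + N - j) (1 - x_i)^(j - 1)) by the
    Vandermonde product.  The proof is by induction on N.  Removing the largest
    entry from a set-valued tableau gives a branching rule over interlacing
    partitions, with a weight that is a product over rows (tabsum_branch), and
    column operations on the determinant yield the same recursion (det_altmxS).

    The other fact is groth_d_delta.  By symmetry the products of Grothendieck
    polynomials have expansions as in the definition of the c^nu_(la,mu).  In
    lowest degree the bialternant formula identifies the product of G_la and the
    Vandermonde product with the alternant det (x_i^(la_j + N - j)), so that one
    coefficient of f times the Vandermonde product gives the coefficient of
    G_rho in f, if |rho| is the lowest degree of f (groth_c_extract).  For
    f = G_R G_nu with a rectangle R, and rho obtained by placing la below R, the
    variables that carry the largest exponents can be removed one after another
    (alternant_peel), and what remains is the coefficient of G_la in G_nu. *)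

Set Implicit Arguments.
Unset Strict Implicit.
Unset Printing Implicit Defensive.

Import Order.TTheory GRing.Theory Num.Theory.

Local Open Scope mset_scope.
Local Open Scope classical_set_scope.
Local Open Scope ring_scope.

(** * Coefficients of power series *)

Lemma fsum_seq (V : nmodType) (J : choiceType) (A : set J) (r : seq J) (F : J -> V) :
  uniq r -> (forall j, j \in r -> A j) -> (forall j, A j -> j \notin r -> F j = 0) ->
  \sum_(j \in A) F j = \sum_(j <- r) F j.
Proof.
move=> ur rA F0; rewrite (fsbigE r) //; rewrite big_seq_cond [RHS]big_seq.
by apply: eq_bigl => j; apply: andb_idr => /rA; rewrite inE.
Qed.

Section Coefficients.
Variable I : choiceType.
Implicit Types (f g h : mseries I) (m a b : {mset I}).

Lemma mem_splits m (p : {mset I} * {mset I}) :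
  (p \in (fset_set (splits m) : seq _)) = ((p.1 `+` p.2)%mset == m).
Proof.
rewrite [LHS](_ : _ = (p \in fset_set (splits m))) //.
rewrite in_fset_set; last exact: finite_splits.
by apply/idP/eqP; rewrite inE.
Qed.

Lemma coefM f g m : (f * g) m = \sum_(p <- fset_set (splits m)) f p.1 * g p.2.
Proof. exact: mseries_mulE. Qed.

Lemma coefD f g m : (f + g) m = f m + g m. Proof. by []. Qed.
Lemma coefN f m : (- f) m = - f m. Proof. by []. Qed.
Lemma coef0 m : (0 : mseries I) m = 0. Proof. by []. Qed.
Lemma coef1 m : (1 : mseries I) m = (m == mset0)%:R. Proof. by []. Qed.

Lemma coef_sum (J : Type) (r : seq J) (P : pred J) (F : J -> mseries I) m :
  (\sum_(j <- r | P j) F j) m = \sum_(j <- r | P j) F j m.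
Proof. by elim/big_rec2: _ => // j y1 y2 _ <-. Qed.

Lemma coefMn f n m : (f *+ n) m = f m *+ n.
Proof. by elim: n => // n IH; rewrite !mulrS coefD IH. Qed.

Lemma coefMz f (z : int) m : (f *~ z) m = f m * z.
Proof.
case: z => n; first by rewrite -pmulrn coefMn pmulrn -mulrzr intz.
by rewrite NegzE !mulrNz coefN -!pmulrn coefMn pmulrn -mulrzr intz mulrN.
Qed.

Lemma coefM_neq0 f g m : (f * g) m != 0 ->
  exists a b, [/\ (a `+` b)%mset = m, f a != 0 & g b != 0].
Proof.
move=> nz; apply: contrapT => no; move/eqP: nz; apply.
rewrite coefM big_seq big1 // => -[a b]; rewrite mem_splits /= => /eqP abm.
apply/eqP; rewrite mulf_eq0; apply: contrapT; move/negP; rewrite negb_or => /andP[fa gb].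
by apply: no; exists a, b.
Qed.

Lemma coefM_unique f g a b :
  (forall a' b', (a' `+` b' = a `+` b)%mset -> f a' != 0 -> g b' != 0 -> (a', b') = (a, b)) ->
  (f * g) (a `+` b)%mset = f a * g b.
Proof.
move=> uni; rewrite coefM (bigD1_seq (a, b)) /= ?mem_splits ?fset_uniq //.
rewrite big_seq_cond big1 ?addr0 // => -[a' b'] /andP[]; rewrite mem_splits /= => /eqP e.
move=> ne; apply/eqP; rewrite mulf_eq0; apply: contraT; rewrite negb_or => /andP[fa gb].
by rewrite (uni _ _ e fa gb) eqxx in ne.
Qed.

(** This is what allows infinite sums and infinitely many variables to be
    truncated before multiplying. *)
Lemma eq_coefM f f' g g' m :
  (forall a, (a `<=` m)%mset -> f a = f' a) -> (forall a, (a `<=` m)%mset -> g a = g' a) ->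
  (f * g) m = (f' * g') m.
Proof.
move=> ff gg; rewrite !coefM big_seq [RHS]big_seq; apply: eq_bigr => -[a b].
rewrite mem_splits /= => /eqP abm; rewrite ff ?gg // -abm; apply/msubsetP => x.
  by rewrite msetE2 leq_addl.
by rewrite msetE2 leq_addr.
Qed.

Definition monom m : mseries I := fun m' => (m' == m)%:R.

Lemma monom_neq0 m m' : monom m m' != 0 -> m' = m.
Proof. by rewrite /monom; case: (m' =P m) => // _; rewrite eqxx. Qed.

Lemma monom0 : monom mset0 = 1. Proof. by []. Qed.

Lemma mvarE k : mvar k = monom [mset k]%mset. Proof. by []. Qed.

Lemma coef_monomM m g m' :
  (monom m * g) m' = if (m `<=` m')%mset then g (m' `\` m)%mset else 0.
Proof.
case: ifP => [le|/negP nle].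
  rewrite -{1}(msetBDKC le) coefM_unique; first by rewrite /monom eqxx mul1r.
  move=> a b e /monom_neq0 am _; rewrite am in e *; congr pair.
  by have := congr1 (fun z => (z `\` m)%mset) e; rewrite /= !msetDKB.
apply/eqP; apply: contraT => /coefM_neq0[a [b [e /monom_neq0 am _]]].
case: nle; rewrite -e am.
by apply/msubsetP => x; rewrite msetE2 leq_addr.
Qed.

Lemma monomD a b : monom (a `+` b)%mset = monom a * monom b.
Proof.
apply/funext => m; rewrite coef_monomM /monom; case: ifP => [le|/negP nle].
  congr (nat_of_bool _)%:R; apply/eqP/eqP => [->|<-]; first by rewrite msetDKB.
  by rewrite msetBDKC.
case: eqP => // e; case: nle; rewrite e.
by apply/msubsetP => x; rewrite msetE2 leq_addr.
Qed.

End Coefficients.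


(** * Weights of monomials *)

Section Weights.
Variable I : choiceType.
Implicit Types (f g h : mseries I) (m a b : {mset I}) (w : I -> nat).

Definition wsum w m : nat := (\sum_(x <- m) w x)%N.

Lemma perm_msetD a b : perm_eq (a `+` b)%mset (a ++ b).
Proof. by apply/allP => x _ /=; rewrite count_cat !count_mem_mset msetE2. Qed.

Lemma wsumD w a b : wsum w (a `+` b)%mset = (wsum w a + wsum w b)%N.
Proof. by rewrite /wsum (perm_big _ (perm_msetD a b)) big_cat. Qed.

Lemma wsum0 w : wsum w mset0 = 0%N.
Proof. by rewrite /wsum big_mset0. Qed.

Lemma wsum1 w k : wsum w [mset k]%mset = w k.
Proof. by rewrite /wsum enum_msetn big_seq1. Qed.

Lemma wsum_sum (J : Type) (r : seq J) (P : pred J) w (F : J -> {mset I}) :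
  wsum w (\big[msetD/mset0]_(j <- r | P j) F j) = (\sum_(j <- r | P j) wsum w (F j))%N.
Proof. by elim/big_rec2: _ => [|j y1 y2 _ <-]; rewrite ?wsum0 ?wsumD. Qed.

Definition val_ge w n f := forall m, f m != 0 -> (n <= wsum w m)%N.

Lemma val_geM w n1 n2 f g : val_ge w n1 f -> val_ge w n2 g -> val_ge w (n1 + n2) (f * g).
Proof.
move=> vf vg m /coefM_neq0[a [b [<- fa gb]]].
by rewrite wsumD leq_add ?vf ?vg.
Qed.

Lemma val_ge1 w : val_ge w 0 1. Proof. by []. Qed.

Lemma val_geW w n1 n2 f : (n1 <= n2)%N -> val_ge w n2 f -> val_ge w n1 f.
Proof. by move=> le vf m /vf; apply: leq_trans. Qed.

Lemma val_ge_coef w n f m : val_ge w n f -> (wsum w m < n)%N -> f m = 0.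
Proof. by move=> vf lt; apply/eqP; apply: contraTT lt => /vf; rewrite leqNgt. Qed.

Lemma val_ge_prod w (J : Type) (r : seq J) (F : J -> mseries I) (n : J -> nat) :
  (forall j, val_ge w (n j) (F j)) -> val_ge w (\sum_(j <- r) n j) (\prod_(j <- r) F j).
Proof. by move=> vF; elim/big_rec2: _ => // j y1 y2 _; apply: val_geM. Qed.

Lemma val_ge_sum w n (J : Type) (r : seq J) (P : pred J) (F : J -> mseries I) :
  (forall j, P j -> val_ge w n (F j)) -> val_ge w n (\sum_(j <- r | P j) F j).
Proof.
move=> vF m nz; rewrite leqNgt; apply: contraNN nz => lt.
by rewrite coef_sum big1 // => j /vF/val_ge_coef; apply.
Qed.

Lemma val_geMz w n f z : val_ge w n f -> val_ge w n (f *~ z).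
Proof. by move=> vf m; rewrite coefMz mulf_eq0 negb_or => /andP[/vf]. Qed.

Lemma val_geN w n f : val_ge w n f -> val_ge w n (- f).
Proof. by move=> vf m; rewrite coefN oppr_eq0; apply: vf. Qed.

Lemma val_ge_monom w m : val_ge w (wsum w m) (monom m).
Proof. by move=> m' /monom_neq0->. Qed.

Lemma coef_mseries_sum (J : choiceType) (A : set J) (F : J -> mseries I) m :
  mseries_sum A F m = \sum_(j \in A) F j m.
Proof. by []. Qed.

Lemma val_ge_mseries_sum w n (J : choiceType) (A : set J) (F : J -> mseries I) :
  (forall j, A j -> val_ge w n (F j)) -> val_ge w n (mseries_sum A F).
Proof.
move=> vF m nz; rewrite leqNgt; apply: contraNN nz => lt; apply/eqP.
by rewrite /mseries_sum; apply: fsbig1 => j Aj; apply: val_ge_coef (vF j Aj) lt.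
Qed.

End Weights.

(** * Leading monomials *)

Section Leading.
Variables (I : choiceType) (D N : I -> nat).
Implicit Types (f g h : mseries I) (m a b : {mset I}).

(** D is the weight that matters; N only separates monomials of equal weight.
    Both are additive, so products of leading monomials are leading. *)
Definition klt a b :=
  ((wsum D a < wsum D b) || (wsum D a == wsum D b) && (wsum N a < wsum N b))%N.

Definition lead f m0 := f m0 = 1 /\ forall m, f m != 0 -> m = m0 \/ klt m0 m.

Lemma lead1 : lead 1 mset0.
Proof.
split=> [|m]; first by rewrite coef1 eqxx.
by rewrite -monom0 => /monom_neq0; left.
Qed.

(** In any other factorization of a monomial a' + b' <= a + b one of the factors
    would have to be below its leading monomial. *)
Lemma leadM f g a b : lead f a -> lead g b -> lead (f * g) (a `+` b)%mset.
Proof.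
move=> [fa lf] [gb lg]; split.
  rewrite coefM_unique ?fa ?gb // => a' b' e fa' gb'.
  have := congr1 (wsum D) e; have := congr1 (wsum N) e; rewrite !wsumD.
  case: (lf _ fa') => [->|]; case: (lg _ gb') => [->|] //; rewrite /klt; lia.
move=> m /coefM_neq0[a' [b' [<- fa' gb']]].
case: (lf _ fa') => [->|]; case: (lg _ gb') => [->|]; rewrite /klt !wsumD; [by left|right;lia..].
Qed.

Lemma lead_prod (J : Type) (r : seq J) (F : J -> mseries I) (M : J -> {mset I}) :
  (forall j, lead (F j) (M j)) -> lead (\prod_(j <- r) F j) (\big[msetD/mset0]_(j <- r) M j).
Proof. by move=> H; elim/big_rec2: _ => [|j y1 y2 _]; [exact: lead1|apply: leadM]. Qed.

End Leading.

(** * Renaming variables *)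

Section Relabel.
Variable I : choiceType.
Implicit Types (f h : mseries I) (m a b : {mset I}) (g : I -> I).

Definition relabel g m : {mset I} := seq_mset (map g m).
(** For a bijection g this is the substitution that sends the variable g k
    to the variable k. *)
Definition act g f : mseries I := fun m => f (relabel g m).

Lemma relabelE g m x : injective g -> relabel g m (g x) = m x.
Proof.
move=> gI; rewrite mset_seqE count_map -[RHS]count_mem_mset.
by apply: eq_count => y /=; rewrite (inj_eq gI).
Qed.

Lemma relabelD g a b : relabel g (a `+` b)%mset = (relabel g a `+` relabel g b)%mset.
Proof.
apply/msetP => x; rewrite msetE2 !mset_seqE -count_cat -map_cat.
by move/seq.permP: (perm_map g (perm_msetD a b)) => ->.
Qed.

Lemma relabel1 g k : relabel g [mset k]%mset = [mset (g k)]%mset.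
Proof. by apply/msetP => x; rewrite mset_seqE enum_msetn /= addn0 msetnE eq_sym; case: eqP. Qed.

Lemma relabel0 g : relabel g mset0 = mset0.
Proof. by apply/msetP => x; rewrite mset_seqE enum_mset0 mset0E. Qed.

Lemma relabel_comp g1 g2 m : relabel g1 (relabel g2 m) = relabel (g1 \o g2) m.
Proof.
apply/eq_seq_msetP; rewrite map_comp; apply: perm_map; exact: perm_eq_seq_mset.
Qed.

Lemma relabel_id g m : (forall x, x \in m -> g x = x) -> relabel g m = m.
Proof.
move=> gid; rewrite /relabel -[RHS]seq_mset_id; congr seq_mset.
by rewrite -[RHS]map_id; apply/eq_in_map.
Qed.

Lemma actD g f h : act g (f + h) = act g f + act g h. Proof. by []. Qed.
Lemma actN g f : act g (- f) = - act g f. Proof. by []. Qed.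
Lemma act0 g : act g 0 = 0. Proof. by []. Qed.
Lemma actMz g f z : act g (f *~ z) = act g f *~ z.
Proof. by apply/funext => m; rewrite coefMz /act coefMz. Qed.

Lemma act_sum g (J : Type) (r : seq J) (P : pred J) (F : J -> mseries I) :
  act g (\sum_(j <- r | P j) F j) = \sum_(j <- r | P j) act g (F j).
Proof. exact: (big_morph _ (actD g) (act0 g)). Qed.

Lemma act_mseries_sum g (J : choiceType) (A : set J) (F : J -> mseries I) :
  act g (mseries_sum A F) = mseries_sum A (fun j => act g (F j)).
Proof. by []. Qed.

Variables (g g' : I -> I) (gK : cancel g g') (g'K : cancel g' g).

Lemma relabelK m : relabel g' (relabel g m) = m.
Proof. by rewrite relabel_comp relabel_id // => x _ /=. Qed.

Lemma relabelK' m : relabel g (relabel g' m) = m.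
Proof. by rewrite relabel_comp relabel_id // => x _ /=. Qed.

Lemma act_monom m : act g (monom m) = monom (relabel g' m).
Proof.
apply/funext => m'; rewrite /act /monom; congr (nat_of_bool _)%:R.
by apply/eqP/eqP => [<-|->]; rewrite ?relabelK ?relabelK'.
Qed.

Lemma act_mvar k : act g (mvar k) = mvar (g' k).
Proof. by rewrite !mvarE act_monom relabel1. Qed.

Lemma act1 : act g 1 = 1.
Proof. by rewrite -monom0 act_monom relabel0. Qed.

Lemma act_1B f : act g (1 - f) = 1 - act g f.
Proof. exact: (congr1 (fun h : mseries I => h - act g f) act1). Qed.

Lemma actM f h : act g (f * h) = act g f * act g h.
Proof.
apply/funext => m; rewrite {1}/act !coefM.
have pe : perm_eq (fset_set (splits (relabel g m)))
   [seq (relabel g p.1, relabel g p.2) | p <- fset_set (splits m)].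
  apply: uniq_perm; rewrite ?fset_uniq //.
    rewrite map_inj_uniq ?fset_uniq // => -[a b] [a' b'] /= [ea eb].
    by rewrite -(relabelK a) ea -(relabelK b) eb !relabelK.
  move=> [a b]; rewrite mem_splits /=; apply/eqP/mapP => [e|[[c d] + [-> ->]]].
    exists (relabel g' a, relabel g' b); rewrite /= ?relabelK' //.
    by rewrite mem_splits /= -relabelD e relabelK.
  by rewrite mem_splits /= -relabelD => /eqP ->.
by rewrite (perm_big _ pe) big_map.
Qed.

Lemma act_prod (J : Type) (r : seq J) (P : pred J) (F : J -> mseries I) :
  act g (\prod_(j <- r | P j) F j) = \prod_(j <- r | P j) act g (F j).
Proof. exact: (big_morph _ actM act1). Qed.

Lemma actX f n : act g (f ^+ n) = act g f ^+ n.
Proof. by elim: n => [|n IH]; rewrite ?expr0 ?act1 // !exprS actM IH. Qed.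

End Relabel.

(** * Unitriangular expansions *)

(** Series that are invariant under a relation sim on monomials are determined
    by their coefficients at the representatives mon j.  On these coefficients
    the family F is unitriangular for a well-founded relation with finite lower
    sets, so the coefficients of an expansion are given by a recursion. *)
Section Triangular.
Variables (I J : choiceType) (sim : {mset I} -> {mset I} -> Prop).
Variables (mon : J -> {mset I}) (F : J -> mseries I) (R : J -> J -> Prop).
Hypothesis Rwf : well_founded R.
Hypothesis Rfin : forall k, finite_set [set j | R j k].
Hypothesis Fmon : forall j, F j (mon j) = 1.
Hypothesis Ftri : forall j k, F j (mon k) != 0 -> j = k \/ R j k.
Hypothesis mon_rep : forall m, exists j, sim m (mon j).
Hypothesis F_sim : forall j m m', sim m m' -> F j m = F j m'.

Let lower k : seq J := fset_set [set j | R j k].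

Let mem_lower j k : (j \in lower k) <-> R j k.
Proof.
rewrite /lower [_ \in _](_ : _ = (j \in fset_set [set j | R j k])) //.
by rewrite in_fset_set //; rewrite inE.
Qed.

Let Rirr k : ~ R k k.
Proof. by elim/(well_founded_ind Rwf): k => k IH Rkk; exact: (IH k Rkk Rkk). Qed.

Let summable_F (c : J -> int) : summable setT (fun j => F j *~ c j).
Proof.
move=> m; have [k mk] := mon_rep m.
apply: (@sub_finite_set _ _ ([set k] `|` [set j | R j k])); last first.
  by rewrite finite_setU; split.
move=> j [_ /=]; rewrite coefMz (F_sim j mk) mulf_eq0 negb_or => /andP[/Ftri[->|jk] _].
  exact: or_introl.
exact: or_intror.
Qed.

Let sum_mon (c : J -> int) k :
  mseries_sum setT (fun j => F j *~ c j) (mon k) =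
  c k + \sum_(j <- lower k) F j (mon k) * c j.
Proof.
rewrite /mseries_sum (fsum_seq (r := k :: lower k)) //; last first.
- move=> j _; rewrite inE negb_or => /andP[jk jl]; rewrite coefMz.
  case: (eqVneq (F j (mon k)) 0) => [->|/Ftri[e|]]; first by rewrite mul0r.
    by rewrite e eqxx in jk.
  by move/mem_lower => e; rewrite e in jl.
- by rewrite /= fset_uniq andbT; apply/negP => /mem_lower/Rirr.
rewrite big_cons coefMz Fmon mul1r; congr (_ + _).
by apply: eq_bigr => j _; rewrite coefMz.
Qed.

(** Evaluating at the representatives turns the infinite sum into a system of
    finite equations. *)
Lemma sums_to_triangular (f : mseries I) (c : J -> int) :
  (forall m m', sim m m' -> f m = f m') ->
  sums_to setT (fun j => F j *~ c j) f <->
  forall k, f (mon k) = c k + \sum_(j <- lower k) F j (mon k) * c j.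
Proof.
move=> f_sim; split=> [[_ <-] k|H]; first by rewrite sum_mon.
split; first exact: summable_F.
apply/funext => m; have [k mk] := mon_rep m.
rewrite (f_sim _ _ mk) H -sum_mon /mseries_sum.
by apply: eq_fsbigr => j _; rewrite !coefMz (F_sim j mk).
Qed.

Lemma triangular_expansion (f : mseries I) :
  (forall m m', sim m m' -> f m = f m') ->
  exists! c : J -> int, sums_to setT (fun j => F j *~ c j) f.
Proof.
move=> f_sim.
pose step (k : J) (rec : forall j, R j k -> int) : int :=
  f (mon k) - \sum_(j <- lower k)
     F j (mon k) * (if pselect (R j k) is left r then rec j r else 0).
pose c := Fix Rwf (fun _ => int) step.
have cE k : c k = f (mon k) - \sum_(j <- lower k) F j (mon k) * c j.
  rewrite /c Fix_eq => [|x r1 r2 e]; last first.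
    rewrite /step; congr (_ - _); apply: eq_bigr => j _; congr (_ * _).
    by case: pselect => // r; rewrite e.
  rewrite /step -/step; congr (_ - _); rewrite big_seq [RHS]big_seq.
  apply: eq_bigr => j /mem_lower jk; congr (_ * _).
  by case: pselect.
exists c; split.
  by apply/sums_to_triangular => // k; rewrite cE subrK.
move=> c' /(sums_to_triangular _ f_sim) H; apply/funext => k.
elim/(well_founded_ind Rwf): k => k IH; rewrite cE.
have := H k => ->; rewrite (_ : \sum_(j <- _) _ = \sum_(j <- lower k) F j (mon k) * c' j) ?addrK //.
rewrite big_seq [RHS]big_seq; apply: eq_bigr => j /mem_lower jk; congr (_ * _).
exact: IH.
Qed.

End Triangular.

(** * Set-valued tableaux by layers *)

(** Tableaux are considered on an arbitrary set L of boxes with coordinates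
    rw and cl, so that the boxes with small entries can again serve as L. *)
Section Tableaux.
Variables (G : finType) (rw cl : G -> nat) (M : nat).
Implicit Types (b : G) (L mu u : {set G}) (t : {ffun G -> {set 'I_M}}).

Definition right_of b b' := (rw b' == rw b) && (cl b' == (cl b).+1).
Definition below b b' := (rw b' == (rw b).+1) && (cl b' == cl b).

Definition tableau L t : bool := `[< [/\ forall b, (t b != finset.set0) = (b \in L),
  forall b b', right_of b b' -> forall x y, x \in t b -> y \in t b' -> (x <= y)%N
  & forall b b', below b b' -> forall x y, x \in t b -> y \in t b' -> (x < y)%N] >].

Definition entries_lt N t : bool := `[< forall b x, x \in t b -> (x < N)%N >].

Variables (R : comNzRingType) (x : 'I_M -> R).

(** The sign (-1) ^ (|T| - |la|) is distributed over the boxes; the boxes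
    outside L are empty and contribute 1. *)
Definition tab_weight t : R := \prod_b ((-1) ^+ (#|t b|.-1) * \prod_(k in t b) x k).

Definition tabsum N L : R := \sum_(t | tableau L t && entries_lt N t) tab_weight t.

(** mu is the set of boxes with an entry smaller than the largest entry k, and
    u the set of boxes that contain k: those conditions on neighbouring boxes
    that involve k depend on these two sets only. *)
Definition strip_cond mu u L : bool := `[< [/\ mu :|: u = L,
  forall b b', b \in u -> right_of b b' -> b' \notin mu
  & forall b b', b \in u -> below b b' -> b' \notin L] >].

Definition tab_supp t : {set G} := [set b | t b != finset.set0]%SET.

Lemma tabsum_set0 N : tabsum N finset.set0 = 1.
Proof.
pose t0 : {ffun G -> {set 'I_M}} := [ffun=> finset.set0].
rewrite /tabsum (big_pred1 t0) => [|t].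
  by rewrite /tab_weight big1 // => b _; rewrite ffunE cards0 expr0 mul1r big_set0.
apply/andP/eqP => [[/asboolP[tL _ _] _]|->].
  by apply/ffunP => b; rewrite ffunE; apply/eqP; have := tL b; rewrite inE => /negbFE.
by split; apply/asboolP; [split=> [b|b b' _ y z|b b' _ y z]|move=> b y]; rewrite ffunE inE ?eqxx.
Qed.

Lemma tabsum0 L : tabsum 0 L = (L == finset.set0)%:R.
Proof.
have [->|/set0Pn[b bL]] := eqVneq L finset.set0; first exact: tabsum_set0.
rewrite /tabsum big1 // => t /andP[/asboolP[tL _ _] /asboolP t0'].
by have := tL b; rewrite bL => /set0Pn[y /t0'].
Qed.

Section Layer.
Variables (N : nat) (ltNM : (N < M)%N).
Let k : 'I_M := Ordinal ltNM.

Definition tab_strip t : {ffun G -> {set 'I_M}} := [ffun b => t b :\ k].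
Definition tab_layer t : {set G} := [set b | k \in t b]%SET.
Definition tab_add u t : {ffun G -> {set 'I_M}} :=
  [ffun b => if b \in u then k |: t b else t b].

Let mem_add u t b y : (y \in tab_add u t b) = (y == k) && (b \in u) || (y \in t b).
Proof. by rewrite ffunE; case: ifP => _; rewrite ?inE ?andbT ?andbF. Qed.

Let tab_addP u t L : entries_lt N t ->
  tableau L (tab_add u t) = tableau (tab_supp t) t && strip_cond (tab_supp t) u L.
Proof.
move=> /asboolP ltN; have nk b : k \in t b = false.
  by apply/negP => /ltN; rewrite ltnn.
have eqk (y : 'I_M) : (y == k) = (y == N :> nat) by [].
apply/asboolP/andP => [[tL tR tB]|[/asboolP[_ tR tB] /asboolP[muL uR uB]]].
  have LE : tab_supp t :|: u = L.
    apply/setP => b; rewrite -tL !inE; apply/orP/set0Pn => [[/set0Pn[y yt]|bu]|[y]].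
    - by exists y; rewrite mem_add yt orbT.
    - by exists k; rewrite mem_add eqxx bu.
    - by rewrite mem_add => /orP[/andP[_ ->]|yt]; [right|left; apply/set0Pn; exists y].
  split; apply/asboolP; split.
  - by move=> b; rewrite inE.
  - by move=> b b' bb' y z yt zt; apply: (tR b b'); rewrite ?mem_add ?yt ?zt ?orbT.
  - by move=> b b' bb' y z yt zt; apply: (tB b b'); rewrite ?mem_add ?yt ?zt ?orbT.
  - by [].
  - move=> b b' bu bb'; rewrite inE negbK; apply/set0Pn => -[y yt].
    have := tR b b' bb' k y; rewrite !mem_add eqxx bu yt orbT => /(_ isT isT) /=.
    by rewrite leqNgt (ltN _ _ yt).
  - move=> b b' bu bb'; rewrite -tL; apply/negP => /set0Pn[y yt].
    have := tB b b' bb' k y _ yt; rewrite mem_add eqxx bu => /(_ isT) /=.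
    move: yt; rewrite mem_add eqk => /orP[/andP[/eqP-> _]|/ltN]; first by rewrite ltnn.
    by move=> lt; rewrite ltnNge (ltnW lt).
split.
- move=> b; rewrite -muL !inE; apply/set0Pn/orP => [[y]|[/set0Pn[y yt]|bu]].
  + by rewrite mem_add => /orP[/andP[_ ->]|yt]; [right|left; apply/set0Pn; exists y].
  + by exists y; rewrite mem_add yt orbT.
  + by exists k; rewrite mem_add eqxx bu.
- move=> b b' bb' y z; rewrite !mem_add => /orP[/andP[/eqP-> bu]|yt] /orP[/andP[/eqP-> bu']|zt] //.
  + by have := uR _ _ bu bb'; rewrite inE => /negP[]; apply/set0Pn; exists z.
  + exact/ltnW/(ltN b).
  + exact: tR bb' _ _ yt zt.
- move=> b b' bb' y z yt zt.
  have b'L : b' \in L.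
    rewrite -muL !inE; move: zt; rewrite mem_add => /orP[/andP[_ ->]|zt]; rewrite ?orbT //.
    by apply/orP; left; apply/set0Pn; exists z.
  move: yt zt; rewrite !mem_add => /orP[/andP[/eqP-> bu]|yt].
    by move=> _; have := uB _ _ bu bb'; rewrite b'L.
  move=> /orP[/andP[/eqP-> bu']|zt]; first exact: (ltN b).
  exact: tB bb' _ _ yt zt.
Qed.

Let add_lt u t : entries_lt N t -> entries_lt N.+1 (tab_add u t).
Proof.
move=> /asboolP ltN; apply/asboolP => b y; rewrite mem_add.
by move=> /orP[/andP[/eqP-> _]|/ltN/ltnW].
Qed.

Let strip_lt t : entries_lt N.+1 t -> entries_lt N (tab_strip t).
Proof.
move=> /asboolP ltN; apply/asboolP => b y; rewrite ffunE !inE => /andP[yk /ltN].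
by rewrite ltnS leq_eqVlt => /orP[/eqP e|//]; rewrite -val_eqE /= e eqxx in yk.
Qed.

Let stripK t : tab_add (tab_layer t) (tab_strip t) = t.
Proof.
apply/ffunP => b; rewrite !ffunE inE; case: ifP => kb; first exact: finset.setD1K.
by apply/setP => y; rewrite !inE; case: eqP => // ->; rewrite kb.
Qed.

Let addK u t : entries_lt N t -> (tab_strip (tab_add u t), tab_layer (tab_add u t)) = (t, u).
Proof.
move=> /asboolP ltN; have nk b : k \in t b = false.
  by apply/negP => /ltN; rewrite ltnn.
congr pair; last by apply/setP => b; rewrite inE mem_add eqxx nk orbF.
apply/ffunP => b; rewrite !ffunE; apply/setP => y; case: ifP => _; rewrite !inE.
  by case: eqP => //= ->; rewrite nk.
by case: eqP => //= ->; rewrite nk.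
Qed.

Let weight_add u t : entries_lt N t -> tab_weight (tab_add u t) =
  tab_weight t * \prod_(b in u) (if b \in tab_supp t then - x k else x k).
Proof.
move=> /asboolP ltN; have nk b : k \in t b = false.
  by apply/negP => /ltN; rewrite ltnn.
rewrite /tab_weight [\prod_(b in u) _]big_mkcond -big_split /=; apply: eq_bigr => b _.
rewrite ffunE; case: ifP => bu; last by rewrite mulr1.
rewrite cardsU1 nk /= big_setU1 ?nk //= inE -card_gt0.
case: posnP => [/eqP|]; first by rewrite cards_eq0 => /eqP ->; rewrite cards0 big_set0 /=; ring.
by move=> /prednK {1}<-; rewrite exprS; ring.
Qed.

(** Removing the entry k = N from a tableau.  The boxes of u that belong to mu
    lose one of several entries, which accounts for the sign. *)
Lemma tabsumS L : tabsum N.+1 L = \sum_mu \sum_(u | strip_cond mu u L)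
  (\prod_(b in u) (if b \in mu then - x k else x k)) * tabsum N mu.
Proof.
rewrite /tabsum (reindex_onto (fun p => tab_add p.2 p.1) (fun t => (tab_strip t, tab_layer t))) /=;
  last by move=> t _; exact: stripK.
transitivity (\sum_(p : {ffun G -> {set 'I_M}} * {set G} |
   (entries_lt N p.1 && tableau (tab_supp p.1) p.1) && strip_cond (tab_supp p.1) p.2 L)
     tab_weight (tab_add p.2 p.1)).
  apply: eq_bigl => -[t u] /=; apply/andP/andP => [[/andP[tab lt] /eqP e]|[/andP[lt tab] c]].
    have lt' : entries_lt N t by case: e => <- _; apply: strip_lt.
    by move: tab; rewrite tab_addP // => /andP[-> ->]; rewrite lt'.
  by rewrite addK // eqxx tab_addP // tab c add_lt.
rewrite -(pair_big_dep (fun t => entries_lt N t && tableau (tab_supp t) t)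
  (fun t u => strip_cond (tab_supp t) u L) (fun t u => tab_weight (tab_add u t))) /=.
rewrite (partition_big tab_supp xpredT) //=; apply: eq_bigr => mu _.
under [RHS]eq_bigr do rewrite mulr_sumr.
rewrite [RHS]exchange_big /=; apply: eq_big => [t|t /andP[/andP[lt _] /eqP <-]].
  have [<-|ne] := tab_supp t =P mu; first by rewrite andbT andbC.
  rewrite andbF; apply/esym/negP => /andP[/asboolP[tL _ _] _].
  by case: ne; apply/setP => b; rewrite inE tL.
by apply: eq_bigr => u _; rewrite weight_add // mulrC.
Qed.
End Layer.
End Tableaux.

(** * Branching over interlacing partitions *)

Section Branching.
Variable la0 : intpart.
Local Notation G := (box la0).
Local Notation sh := (nth 0%N la0).
Local Notation rw := (@box_row la0).
Local Notation cl := (@box_col la0).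

Lemma box_row_lt (b : G) : (rw b < size la0)%N. Proof. exact: ltn_ord. Qed.
Lemma box_col_lt (b : G) : (cl b < sh (rw b))%N. Proof. exact: ltn_ord. Qed.

Lemma box_exists r c : (c < sh r)%N -> exists b : G, rw b = r /\ cl b = c.
Proof.
move=> cr; have rp : (r < size la0)%N.
  by rewrite ltnNge; apply: contraTN cr => /(nth_default 0%N) ->.
by exists (existT _ (Ordinal rp) (Ordinal (cr : (c < sh (Ordinal rp))%N))).
Qed.

Lemma box_inj (b b' : G) : rw b = rw b' -> cl b = cl b' -> b = b'.
Proof.
case: b b' => [r c] [r' c']; rewrite /box_row /box_col /= => /val_inj e.
by case: _ / e c' => c' /val_inj ->.
Qed.

Lemma prod_box (R : comNzRingType) (F : nat -> nat -> R) :
  \prod_(b : G) F (rw b) (cl b) = \prod_(r < size la0) \prod_(c < sh r) F r c.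
Proof. by rewrite sig_big_dep. Qed.

Definition diagram (la : nat -> nat) : {set G} := [set b | (cl b < la (rw b))%N]%SET.

Definition rowlen (mu : {set G}) (r : nat) : nat :=
  \max_(b in mu | rw b == r) (cl b).+1.

Lemma rowlen_diagram la r : (la r <= sh r)%N -> rowlen (diagram la) r = la r.
Proof.
move=> le; apply/eqP; rewrite eqn_leq; apply/andP; split.
  by apply/bigmax_leqP => b; rewrite inE => /andP[lt /eqP <-].
case E: (la r) => [//|c].
have [|b [br bc]] := @box_exists r c; first by apply: leq_trans le; rewrite E.
rewrite -bc; apply: leq_bigmax_cond; by rewrite inE br bc E leqnn eqxx.
Qed.

Variables (K q : nat) (leK : (size la0 <= K)%N) (leq_sh : forall r, (sh r <= q)%N).

(** Vectors of row lengths, as a finite type over which sums can be taken; the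
    bounds K and q need only be large enough. *)
Definition rows := {ffun 'I_K -> 'I_q.+1}.
Definition row_fun (m : rows) (r : nat) : nat :=
  if insub r is Some i then m i else 0%N.

Lemma row_funE (m : rows) (i : 'I_K) : row_fun m i = m i.
Proof. by rewrite /row_fun valK. Qed.

Lemma row_fun_ge (m : rows) r : (K <= r)%N -> row_fun m r = 0%N.
Proof. by move=> le; rewrite /row_fun insubN // -leqNgt. Qed.

Definition interlace (la : nat -> nat) (m : rows) : bool :=
  [forall r : 'I_K, (la r.+1 <= m r <= la r)%N].

Variables (M : nat) (R : comNzRingType) (x : 'I_M -> R).

(** The factor contributed by a row of length a when the entry z is added, if
    c is the length of the part of the row with smaller entries and b the length
    of the next row: z fills the last a - c boxes, and may join the smaller
    entries in the last of the c boxes if there is no box below it. *)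
Definition strip_weight (z : R) (a b c : nat) : R := z ^+ (a - c) * (1 - z) ^+ (b < c)%N.

Variables (N : nat) (ltNM : (N < M)%N) (la : nat -> nat).
Hypotheses (la_sh : forall r, (la r <= sh r)%N) (la_dec : forall r, (la r.+1 <= la r)%N).
Let z := x (Ordinal ltNM).

Let la_ge r : (size la0 <= r)%N -> la r = 0%N.
Proof. by move=> le; apply/eqP; rewrite -leqn0 (leq_trans (la_sh r)) ?nth_default. Qed.

Lemma interlaceP m : reflect (forall r, la r.+1 <= row_fun m r <= la r)%N (interlace la m).
Proof.
apply: (iffP forallP) => [H r|H r]; last by rewrite -row_funE.
have [lt|ge] := ltnP r K; first by have := H (Ordinal lt); rewrite -row_funE.
by rewrite row_fun_ge // !la_ge ?(leq_trans leK) // ltnW.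
Qed.

(* The boxes with smaller entries form a diagram again, and what is added to
   it is a horizontal strip. *)
Let strip_shape mu u : strip_cond rw cl mu u (diagram la) ->
  mu = diagram (rowlen mu) /\ (forall r, la r.+1 <= rowlen mu r <= la r)%N.
Proof.
move=> /asboolP[muL uR uB].
have inL b : (b \in diagram la) = (b \in mu) || (b \in u) by rewrite -muL inE.
have closed b b' : b' \in mu -> rw b = rw b' -> (cl b <= cl b')%N -> b \in mu.
  move=> b'mu e; have [d] := ubnP (cl b' - cl b); elim: d b e => // d IH b e ltd.
  rewrite leq_eqVlt => /orP[/eqP ec|lt]; first by rewrite (box_inj e ec).
  have [|b2 [r2 c2]] := @box_exists (rw b) (cl b).+1.
    by rewrite e (leq_ltn_trans lt) ?box_col_lt.
  have b2mu : b2 \in mu by apply: IH; rewrite ?r2 ?c2 //; lia.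
  have : b \in diagram la.
    rewrite inE e; apply: leq_ltn_trans (ltnW lt) _.
    by have := inL b'; rewrite b'mu inE.
  rewrite inL => /orP[//|/uR] /(_ b2); rewrite b2mu /right_of r2 c2 !eqxx.
  by move=> /(_ isT).
have muE : mu = diagram (rowlen mu).
  apply/setP => b; rewrite inE; apply/idP/idP => [bmu|].
    by apply: (@leq_bigmax_cond _ _ (fun b => (cl b).+1)); rewrite bmu eqxx.
  rewrite /rowlen; case: (pickP (fun b' => (b' \in mu) && (rw b' == rw b))) => [b1 b1P|none].
    have [b' /andP[b'mu /eqP e] ->] := eq_bigmax_cond (fun b => (cl b).+1)
       (ltac:(by apply/card_gt0P; exists b1) : (0 < #|[pred b' | (b' \in mu) && (rw b' == rw b)]|)%N).
    by rewrite ltnS => le; apply: (closed _ b').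
  by rewrite big_pred0.
split=> // r; apply/andP; split; last first.
  apply/bigmax_leqP => b /andP[bmu /eqP <-].
  by have := inL b; rewrite bmu inE.
case E: (la r.+1) => [//|c].
have ltc : (c < la r)%N by rewrite -E.
have [|b [br bc]] := @box_exists r c; first exact: leq_trans (la_sh r).
have [|b' [b'r b'c]] := @box_exists r.+1 c; first by rewrite (leq_trans _ (la_sh _)) ?E.
have : b \in diagram la by rewrite inE br bc.
rewrite inL => /orP[bmu|bu].
  by rewrite -bc -br; apply: (@leq_bigmax_cond _ _ (fun b => (cl b).+1)); rewrite bmu eqxx.
by have := uB b b' bu; rewrite /below br bc b'r b'c !eqxx inE b'r b'c E leqnn => /(_ isT).
Qed.

Let box_weight (mu : nat -> nat) (r c : nat) : R :=
  (if [&& c < la r, ~~ (c.+1 < mu r) & ~~ (c < la r.+1)]%N then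
     (if (c < mu r)%N then - z else z) else 0) +
  (if (c < la r)%N && ~~ (c < mu r)%N then 0 else 1).

(* Given mu, the boxes can be put into u independently of each other: box_weight
   adds up the contributions of the two possibilities. *)
Let sum_strips (mu : nat -> nat) : (forall r, la r.+1 <= mu r <= la r)%N ->
  \sum_(u | strip_cond rw cl (diagram mu) u (diagram la))
    \prod_(b in u) (if b \in diagram mu then - z else z) =
  \prod_(b : G) box_weight mu (rw b) (cl b).
Proof.
move=> inter; rewrite /box_weight.
have mu_sh r : (mu r <= sh r)%N by have /andP[_ h] := inter r; apply: leq_trans h (la_sh r).
pose X b : R := if [&& cl b < la (rw b), ~~ ((cl b).+1 < mu (rw b)) & ~~ (cl b < la (rw b).+1)]%N
   then (if (cl b < mu (rw b))%N then - z else z) else 0.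
pose Y b : R := if (cl b < la (rw b))%N && ~~ (cl b < mu (rw b))%N then 0 else 1.
pose ok (u : {set G}) b := if b \in u then
   [&& cl b < la (rw b), ~~ ((cl b).+1 < mu (rw b)) & ~~ (cl b < la (rw b).+1)]%N
   else ~~ ((cl b < la (rw b))%N && ~~ (cl b < mu (rw b))%N).
have okP u : strip_cond rw cl (diagram mu) u (diagram la) = [forall b, ok u b].
  apply/asboolP/forallP => [[muL uR uB] b|H].
    have := muL => /setP/(_ b); rewrite !inE /ok; case: ifP => bu; last first.
      by rewrite orbF => ->; case: ltnP.
    rewrite orbT => /esym ltb; rewrite ltb /=; apply/andP; split; apply/negP => lt.
      have [|b' [b'r b'c]] := @box_exists (rw b) (cl b).+1; first exact: leq_trans lt (mu_sh _).
      by have := uR b b' bu; rewrite /right_of b'r b'c !eqxx inE b'r b'c lt => /(_ isT).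
    have [|b' [b'r b'c]] := @box_exists (rw b).+1 (cl b); first exact: leq_trans lt (la_sh _).
    by have := uB b b' bu; rewrite /below b'r b'c !eqxx inE b'r b'c lt => /(_ isT).
  split.
  - apply/setP => b; have := H b; rewrite /ok !inE; case: ifP => bu.
      by move=> /and3P[-> _ _]; rewrite orbT.
    have /andP[_ le] := inter (rw b); rewrite orbF => nH; apply/idP/idP => lt.
      exact: leq_trans lt le.
    by move: nH; rewrite lt /= negbK.
  - move=> b b' bu /andP[/eqP er /eqP ec]; have := H b; rewrite /ok bu inE er ec.
    by move=> /and3P[].
  - move=> b b' bu /andP[/eqP er /eqP ec]; have := H b; rewrite /ok bu inE er ec.
    by move=> /and3P[].
transitivity (\prod_b (X b + Y b)); last by [].
rewrite bigA_distr big_mkcond /=; apply: eq_bigr => u _.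
rewrite okP; case: ifP => [/forallP H|/negbT]; last first.
  rewrite negb_forall => /existsP[b nok]; rewrite (bigD1 b) //= [X in X * _](_ : _ = 0) ?mul0r //.
  move: nok; rewrite /ok /X /Y; case: ifP => _; first by move/negbTE->.
  by rewrite negbK => ->.
rewrite big_mkcond; apply: eq_bigr => b _; have := H b; rewrite /ok /X /Y inE.
by case: ifP => _; [move=> -> | move/negbTE->].
Qed.

Let row_weight (mu : nat -> nat) r : (la r.+1 <= mu r <= la r)%N ->
  \prod_(c < sh r) box_weight mu r c = strip_weight z (la r) (la r.+1) (mu r).
Proof.
move=> /andP[le1 le2]; have le3 := la_sh r.
rewrite -(big_mkord xpredT (box_weight mu r)).
rewrite (big_cat_nat (n := mu r)) ?(leq_trans le2) //= (big_cat_nat (n := la r) (m := mu r)) //=.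
rewrite /strip_weight mulrC; congr (_ * _).
  rewrite [X in _ * X]big_nat [X in _ * X]big1 ?mulr1 => [|c /andP[h1 h2]]; last first.
    by rewrite /box_weight ltnNge h1 /= add0r.
  rewrite big_nat; under eq_bigr => c /andP[h1 h2].
    rewrite /box_weight h2 /= !ltnNge h1 (leq_trans h1 (leqnSn c)) (leq_trans le1 h1) /= addr0. over.
  by rewrite -big_nat prodr_const_nat.
case E: (mu r) => [|m]; first by rewrite big_geq // ltn0.
rewrite big_nat_recr //= big_nat big1 ?mul1r => [|c /andP[_ h2]]; last first.
  by rewrite /box_weight E !ltnS h2 (ltnW h2) /= andbF add0r.
rewrite /box_weight E ltnS leqnn ltnn /= andbF.
rewrite ltnS; have -> : (m < la r)%N by rewrite -E.
by rewrite -leqNgt /=; case: ifP => _; rewrite ?expr1 ?expr0 ?add0r // addrC.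
Qed.

(** The rows decouple: the branching rule is a sum over interlacing sequences of
    a product of factors, one for each row. *)
Lemma tabsum_branch :
  tabsum rw cl x N.+1 (diagram la) =
  \sum_(m : rows | interlace la m)
    (\prod_(r < K) strip_weight z (la r) (la r.+1) (m r)) * tabsum rw cl x N (diagram (row_fun m)).
Proof.
rewrite (tabsumS _ _ x ltNM) (bigID (fun mu =>
  [exists m : rows, interlace la m && (mu == diagram (row_fun m))])) /= [X in _ + X]big1 ?addr0.
  2: { move=> mu; rewrite negb_exists => /forallP none; rewrite big1 // => u /strip_shape[muE inter].
       pose m : rows := [ffun r : 'I_K => inord (rowlen mu r)].
       have mE r : row_fun m r = rowlen mu r.
         have [lt|ge] := ltnP r K.
           rewrite (row_funE m (Ordinal lt)) ffunE /= inordK // ltnS.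
           by have /andP[_ h] := inter r; rewrite (leq_trans h) ?(leq_trans (la_sh r)).
         rewrite row_fun_ge //; apply/esym/eqP; rewrite -leqn0.
         by have /andP[_ h] := inter r; rewrite (leq_trans h) ?la_ge ?(leq_trans leK).
       have /negP[] := none m; apply/andP; split; first by apply/interlaceP => r; rewrite mE.
       apply/eqP; rewrite [LHS]muE; apply/setP => b; by rewrite !inE mE. }
pose h (m : rows) := diagram (row_fun m).
pose h' (mu : {set G}) : rows := [ffun r : 'I_K => inord (rowlen mu r)].
have hK m : interlace la m -> h' (h m) = m.
  move=> /interlaceP inter; apply/ffunP => r; rewrite ffunE rowlen_diagram ?row_funE ?inord_val //.
  by rewrite -row_funE; have /andP[_ le] := inter r; apply: leq_trans le (la_sh r).
rewrite (reindex_onto h h') => [|mu /existsP[m /andP[inter /eqP ->]]]; last first.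
  by rewrite -/(h m) hK.
apply: eq_big => [m|m /andP[/existsP[m' /andP[inter' /eqP e]] /eqP hm]].
  apply/andP/idP => [[/existsP[m' /andP[inter' /eqP e]] /eqP hm]|inter].
    by rewrite -hm e -/(h m') hK.
  by rewrite hK //; split=> //; apply/existsP; exists m; rewrite inter eqxx.
have inter : interlace la m by rewrite -hm e -/(h m') hK.
rewrite -mulr_suml; congr (_ * _).
have /interlaceP interm := inter.
rewrite sum_strips // (prod_box (box_weight (row_fun m))).
rewrite (eq_bigr (fun r : 'I_(size la0) => strip_weight z (la r) (la r.+1) (row_fun m r))) => [|r _]; last exact: row_weight.
rewrite -(big_mkord xpredT (fun r => strip_weight z (la r) (la r.+1) (row_fun m r))).
under [RHS]eq_bigr do rewrite -row_funE.
rewrite -[RHS](big_mkord xpredT (fun r => strip_weight z (la r) (la r.+1) (row_fun m r))).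
rewrite [RHS](big_cat_nat (n := size la0)) //= [X in _ = _ * X]big_nat [X in _ = _ * X]big1 ?mulr1 //.
move=> r /andP[ge _]; have /andP[_] := interm r.
rewrite /strip_weight !la_ge // ?(leq_trans ge) // leqn0 => /eqP ->.
by rewrite subnn !expr0 mulr1.
Qed.

End Branching.

(** * The bialternant formula *)

Section Bialternant.
Variables (R : comNzRingType) (y : nat -> R).

(** The numerator of the bialternant formula, with the variables y 0, y 1, ...
    and 0-based column indices. *)
Definition altmx N (la : nat -> nat) : 'M[R]_N :=
  \matrix_(i, j) (y i ^+ (la j + (N.-1 - j)) * (1 - y i) ^+ j).

Definition vandprod N : R := \prod_(i < N) \prod_(j < i) (y j - y i).

Lemma vandprodS N : vandprod N.+1 = vandprod N * \prod_(j < N) (y j - y N).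
Proof. by rewrite /vandprod big_ord_recr. Qed.

Lemma det_sum_cols N (T : finType) (P : 'I_N -> pred T) (g : 'I_N -> T -> R)
    (F : 'I_N -> 'I_N -> T -> R) :
  \det (\matrix_(i, j) \sum_(c | P j c) g j c * F i j c) =
  \sum_(nu : {ffun 'I_N -> T} | [forall j, P j (nu j)])
    (\prod_j g j (nu j)) * \det (\matrix_(i, j) F i j (nu j)).
Proof.
rewrite -[LHS]det_tr [LHS]/determinant.
transitivity (\sum_(s : 'S_N) \sum_(nu : {ffun 'I_N -> T} | [forall j, P j (nu j)])
   (-1) ^+ s * ((\prod_j g j (nu j)) * \prod_j F (s j) j (nu j))).
  apply: eq_bigr => s _; rewrite -mulr_sumr; congr (_ * _).
  under eq_bigr do rewrite !mxE.
  rewrite bigA_distr_big_dep; apply: eq_big => [nu|nu _]; last by rewrite big_split.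
  by apply/familyP/forallP.
rewrite exchange_big; apply: eq_bigr => nu _.
rewrite -det_tr /determinant mulr_sumr; apply: eq_bigr => s _.
by rewrite mulrCA; congr (_ * (_ * _)); apply: eq_bigr => j _; rewrite !mxE.
Qed.

(** The geometric sum over one row.  Multiplied by suitable powers of a and of
    1 - a, the two terms on the right become multiples, by 1 - z and by a power of
    z, of the entries of altmx in two adjacent columns. *)
Lemma sum_strip_weight (a z : R) b d q : (b + d < q.+1)%N ->
  (a - z) * (\sum_(c < q.+1 | (b <= c <= b + d)%N) strip_weight z (b + d) b c * a ^+ c) =
  (1 - z) * a ^+ (b + d).+1 - z ^+ d.+1 * a ^+ b * (1 - a).
Proof.
move=> lt.
rewrite -(big_mkord (fun c => b <= c <= b + d)%N (fun c => strip_weight z (b + d) b c * a ^+ c)).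
rewrite (_ : \sum_(0 <= c < q.+1 | _) _ = \sum_(b <= c < (b + d).+1) strip_weight z (b + d) b c * a ^+ c); last first.
  rewrite (big_cat_nat (n := b)) //=; last by lia.
  rewrite big1_seq ?add0r; last by move=> c /andP[/andP[h _]]; rewrite mem_index_iota; lia.
  rewrite (big_cat_nat (n := (b + d).+1)) //=; last by lia.
  rewrite [X in _ + X]big1_seq ?addr0; last first.
    by move=> c /andP[/andP[_ h]]; rewrite mem_index_iota; lia.
  rewrite big_mkcond big_nat [RHS]big_nat; apply: eq_bigr => c /andP[h1 h2].
  by rewrite h1 /= ifT //; lia.
elim: d {lt} => [|d IH].
  by rewrite addn0 big_nat1 /strip_weight ltnn subnn /= !expr0 expr1 exprS; ring.
rewrite big_nat_recr /=; last by lia.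
rewrite addnS big_nat.
rewrite (eq_bigr (fun c => z * (if (b <= c < (b + d).+1)%N then strip_weight z (b + d) b c * a ^+ c else 0)));
  last first.
  by move=> c /andP[h1 h2]; rewrite h1 h2 /= /strip_weight subSn ?exprS //; ring.
rewrite -big_nat -mulr_sumr.
rewrite (_ : \sum_(b <= c < _) _ = \sum_(b <= c < (b + d).+1) strip_weight z (b + d) b c * a ^+ c); last first.
  by rewrite big_nat [RHS]big_nat; apply: eq_bigr => c ->.
rewrite mulrDr mulrCA IH /strip_weight subnn ltnS leq_addr !exprS; ring.
Qed.

Section Step.
Variables (N q : nat) (la : nat -> nat).
Hypotheses (la_dec : forall r, (la r.+1 <= la r)%N) (la_q : forall r, (la r <= q)%N).
Let z := y N.

Let f j (a : R) : R := a ^+ (la j + (N - j)) * (1 - a) ^+ j.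

(* The matrix of the column operations. *)
Let C : 'M[R]_N.+1 := \matrix_(i, j)
  if i == j then (if j == N :> nat then 1 else 1 - z) else
  if i == j.+1 :> nat then - z ^+ (la j - la j.+1).+1 else 0.

Let detC : \det C = (1 - z) ^+ N.
Proof.
rewrite det_trig; last first.
  apply/is_trig_mxP => i j ij; rewrite mxE; case: eqP => [e|_]; first by rewrite e ltnn in ij.
  by case: eqP => // e; rewrite e in ij; lia.
rewrite big_ord_recr /= mxE eqxx /= eqxx mulr1.
rewrite -[N in RHS]card_ord -prodr_const; apply: eq_bigr => i _.
by rewrite mxE eqxx /= ltn_eqF.
Qed.

Let AC (i j : 'I_N.+1) : (altmx N.+1 la *m C) i j =
  if j == N :> nat then f j (y i) else
  (1 - z) * f j (y i) - z ^+ (la j - la j.+1).+1 * f j.+1 (y i).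
Proof.
rewrite mxE (bigD1 j) //= !mxE eqxx /= -/(f j (y i)).
case: ifP => [/eqP jN|/eqP jN].
  rewrite big1 ?addr0 ?mulr1 // => k kj; rewrite !mxE (negbTE kj).
  case: eqP => [e|_]; last by rewrite mulr0.
  by have := ltn_ord k; rewrite e jN ltnn.
have ltj : (j.+1 < N.+1)%N by have := ltn_ord j; lia.
rewrite (bigD1 (Ordinal ltj)) /=; last by rewrite -val_eqE /=; lia.
rewrite !mxE /= eqxx -val_eqE /=; case: (j.+1 =P j :> nat) => [|_]; first lia.
rewrite big1 ?addr0 => [|k /andP[k1 k2]].
  by rewrite -/(f j.+1 (y i)); ring.
rewrite !mxE (negbTE k1); case: eqP => [e|_]; last by rewrite mulr0.
by rewrite -val_eqE /= e eqxx in k2.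
Qed.

(** Column operations clear the last row except for its last entry.  By
    sum_strip_weight, what they produce in the other rows is the branching rule,
    up to a factor y i - z in row i.  The operations multiply columns by 1 - z,
    and this factor is kept on both sides as it need not be invertible. *)
Lemma det_altmxS : \det (altmx N.+1 la) * (1 - z) ^+ N =
  (z ^+ la N * (\prod_(i < N) (y i - z)) *
   \sum_(nu : {ffun 'I_N -> 'I_q.+1} | [forall j : 'I_N, (la j.+1 <= nu j <= la j)%N])
    (\prod_(j < N) strip_weight z (la j) (la j.+1) (nu j)) *
      \det (\matrix_(i < N, j < N) (y i ^+ (nu j + (N.-1 - j)) * (1 - y i) ^+ j)))
  * (1 - z) ^+ N.
Proof.
rewrite -[X in _ * X = _]detC -det_mulmx (expand_det_row _ ord_max) (bigD1 ord_max) //=.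
rewrite [X in _ + X]big1 ?addr0 => [|j jN]; last first.
  rewrite AC; case: ifP => [e|_]; first by rewrite -val_eqE /= e in jN.
  rewrite /f -/z /= [X in X * _](_ : _ = 0) ?mul0r //.
  have lej : (j < N)%N by have := ltn_ord j; rewrite -val_eqE /= in jN; lia.
  have -> : (N - j = (N - j.+1).+1)%N by lia.
  have {1}-> : (la j = la j.+1 + (la j - la j.+1))%N by rewrite subnKC.
  move: (la j - la j.+1)%N (N - j.+1)%N => d e.
  by rewrite !addnS !exprD !exprS !exprD; ring.
rewrite AC /= eqxx /f subnn addn0 -/z /cofactor -signr_odd addnn odd_double expr0 mul1r.
rewrite mulrAC; congr (_ * _); rewrite -mulrA; congr (_ * _).
rewrite -(@det_sum_cols N 'I_q.+1 (fun j c => la j.+1 <= c <= la j)%N (fun j c => strip_weight z (la j) (la j.+1) c)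
  (fun i j c => y i ^+ (c + (N.-1 - j)) * (1 - y i) ^+ j)).
pose d := \row_(i < N) (y i - z).
rewrite (_ : \prod_(i < N) (y i - z) = \det (diag_mx d)); last first.
  by rewrite det_diag; apply: eq_bigr => i _; rewrite mxE.
rewrite -det_mulmx mul_diag_mx; congr (\det _); apply/matrixP => i j.
rewrite !mxE.
transitivity ((altmx N.+1 la *m C) (lift ord_max i) (lift ord_max j)); first by rewrite [RHS]mxE.
have ltj : (j < N)%N by exact: ltn_ord.
rewrite AC !lift_max ltn_eqF //.
pose c := (N.-1 - j)%N; pose e := (la j - la j.+1)%N.
have lajE : (la j = la j.+1 + e)%N by rewrite subnKC.
transitivity ((y i - z) * (\sum_(k < q.+1 | (la j.+1 <= k <= la j.+1 + e)%N)
   strip_weight z (la j.+1 + e) (la j.+1) k * y i ^+ k) * (y i ^+ c * (1 - y i) ^+ j)); last first.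
  rewrite -mulrA mulr_suml -lajE; congr (_ * _); apply: eq_bigr => k _.
  by rewrite exprD -/c; ring.
rewrite sum_strip_weight -?lajE ?ltnS // /f lajE (_ : N - j = c.+1)%N; last by rewrite /c; lia.
rewrite (_ : N - j.+1 = c)%N; last by rewrite /c; lia.
by rewrite (_ : la j.+1 + e - la j.+1 = e)%N ?addKn // !addnS !exprD !exprS !exprD; ring.
Qed.
End Step.

Lemma sum_rows_restrict N K q (F : (nat -> nat) -> R) (leNK : (N <= K)%N) :
  (forall m m' : nat -> nat, m =1 m' -> F m = F m') ->
  \sum_(m : rows K q | [forall r : 'I_K, (N <= r)%N ==> (m r == 0%N :> nat)]) F (row_fun m) =
  \sum_(nu : rows N q) F (row_fun nu).
Proof.
move=> eqF.
pose h (nu : rows N q) : rows K q := [ffun r : 'I_K => inord (row_fun nu r)].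
pose h' (m : rows K q) : rows N q := [ffun j : 'I_N => inord (row_fun m j)].
have row_lt L (m : rows L q) r : (row_fun m r < q.+1)%N.
  by rewrite /row_fun; case: insubP => // i _ _; exact: ltn_ord.
have hE nu : row_fun (h nu) =1 row_fun nu.
  move=> r; have [lt|ge] := ltnP r K.
    by rewrite (row_funE (h nu) (Ordinal lt)) ffunE; apply: inordK.
  by rewrite !row_fun_ge // (leq_trans leNK).
rewrite (reindex_onto h h') => [|m /forallP m0].
  apply: eq_big => [nu|nu _]; last exact: eqF.
  apply/andP; split.
    apply/forallP => r; apply/implyP => le.
    by rewrite -row_funE hE row_fun_ge.
  by apply/eqP/ffunP => j; rewrite ffunE hE row_funE inord_val.
apply/ffunP => r; apply/val_inj; rewrite ffunE /= inordK //.
have [lt|ge] := ltnP r N.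
  rewrite (row_funE (h' m) (Ordinal lt)) ffunE [LHS]inordK //.
  exact: row_funE.
by rewrite row_fun_ge //; have /implyP/(_ ge)/eqP := m0 r.
Qed.

End Bialternant.

Section BialternantDomain.
Variables (R : idomainType) (la0 : intpart) (M : nat) (y : nat -> R).
Hypothesis y1 : forall i, 1 - y i != 0.
Local Notation sh := (nth 0%N la0).
Local Notation tabs := (tabsum (@box_row la0) (@box_col la0) (fun i : 'I_M => y i)).

(** Induction on the number N of variables: by tabsum_branch and det_altmxS both
    sides satisfy the same recursion.  A shape with more than N + 1 rows
    interlaces only shapes with more than N rows, hence the case of 0. *)
Lemma bialternant_domain N (la : nat -> nat) : (N <= M)%N ->
  (forall r, (la r <= sh r)%N) -> (forall r, (la r.+1 <= la r)%N) ->
  vandprod y N * tabs N (diagram la0 la) = if la N == 0%N then \det (altmx y N la) else 0.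
Proof.
elim: N la => [|N IH] la leNM la_sh la_dec.
  rewrite tabsum0 /vandprod big_ord0 mul1r det_mx00.
  case: ifP => [/eqP la0E|/negbT nz].
    rewrite (_ : _ == _ = true) //; apply/eqP/setP => b; rewrite !inE.
    suff -> : la (box_row b) = 0%N by [].
    by elim: (box_row b) => // r IHr; apply/eqP; rewrite -leqn0 -IHr.
  rewrite (_ : _ == _ = false) //; apply/negP => /eqP e.
  have [|b [br bc]] := @box_exists la0 0 0; first by rewrite (leq_trans _ (la_sh 0%N)) // lt0n.
  by have /setP/(_ b) := e; rewrite !inE br bc lt0n nz.
pose K := (size la0 + M)%N; pose q := head 0%N la0.
have leK : (size la0 <= K)%N by rewrite leq_addr.
have leq_sh r : (sh r <= q)%N.
  have := partsP la0; rewrite /is_intpart /q; case: (parts la0) => [|a s] /=; first by rewrite nth_nil.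
  move=> /andP[srt _]; case: r => //= r; have [lt|ge] := ltnP r (size s); last by rewrite nth_default.
  have tr : transitive geq by move=> ? ? ? /= h1 h2; apply: leq_trans h2 h1.
  by have /allP := order_path_min tr srt; apply; apply: mem_nth.
have la_q r : (la r <= q)%N by apply: leq_trans (la_sh r) (leq_sh r).
set z := y N; pose W r c := strip_weight z (la r) (la r.+1) c.
have la_mono : {homo la : r s / (r <= s)%N >-> (s <= r)%N}.
  by apply: homo_leq => // a b c /= h1 h2; apply: leq_trans h2 h1.
have -> : vandprod y N.+1 * tabs N.+1 (diagram la0 la) = (\prod_(j < N) (y j - y N)) *
  \sum_(m : rows K q | interlace la m) (\prod_(r < K) W r (m r)) *
    (if row_fun m N == 0%N then \det (altmx y N (row_fun m)) else 0).
  rewrite (tabsum_branch leK leq_sh (fun i : 'I_M => y i) leNM la_sh la_dec) vandprodS.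
  rewrite mulrAC mulrC; congr (_ * _); rewrite mulr_sumr; apply: eq_bigr => m inter.
  have /(interlaceP leK la_sh) interm := inter.
  rewrite mulrCA -IH //; first exact: ltnW.
    by move=> r; have /andP[_ h] := interm r; apply: leq_trans h (la_sh r).
  move=> r; have /andP[_ h] := interm r.+1; have /andP[h' _] := interm r.
  exact: leq_trans h h'.
have ltNK : (N < K)%N by rewrite /K; lia.
have [la0E|nz] := eqVneq (la N.+1) 0%N; last first.
  rewrite [X in _ * X]big1 ?mulr0 // => m /(interlaceP leK la_sh)/(_ N)/andP[h _].
  by rewrite ifF ?mulr0 //; apply: contra_neqF nz => /eqP e; move: h; rewrite e leqn0 => /eqP.
apply: (mulIf (expf_neq0 N (y1 N))).
rewrite (@det_altmxS R y N q la la_dec la_q) -/z; congr (_ * _).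
rewrite [z ^+ _ * _]mulrC -[RHS]mulrA; congr (_ * _); rewrite mulr_sumr.
pose ok (g : nat -> nat) := [forall j : 'I_N, (la j.+1 <= g j <= la j)%N].
pose F (g : nat -> nat) : R := if ok g
  then z ^+ la N * ((\prod_(j < N) W j (g j)) * \det (altmx y N g)) else 0.
transitivity (\sum_(nu : rows N q) F (row_fun nu)); last first.
  rewrite [RHS]big_mkcond; apply: eq_bigr => nu _; rewrite /F /ok.
  under eq_forallb do rewrite row_funE.
  case: ifP => // _; congr (_ * (_ * _)); first by apply: eq_bigr => j _; rewrite row_funE.
  by congr (\det _); apply/matrixP => i j; rewrite !mxE row_funE.
rewrite -(@sum_rows_restrict _ N K q F (ltnW ltNK)); last first.
  move=> m m' e; rewrite /F /ok; under eq_forallb do rewrite e.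
  case: ifP => // _; congr (_ * (_ * _)); first by apply: eq_bigr => j _; rewrite e.
  by congr (\det _); apply/matrixP => i j; rewrite !mxE e.
rewrite big_mkcond [RHS]big_mkcond; apply: eq_bigr => m _; rewrite /F.
have condE : interlace la m && (row_fun m N == 0%N) =
  [forall r : 'I_K, (N <= r)%N ==> (m r == 0%N :> nat)] && ok (row_fun m).
  apply/andP/andP => [[/(interlaceP leK la_sh) interm /eqP m0]|[/forallP m0 /forallP okm]].
    split; last by apply/forallP => j; exact: interm.
    apply/forallP => r; apply/implyP; rewrite leq_eqVlt => /orP[/eqP e|lt].
      by rewrite -row_funE -e m0.
    rewrite -row_funE -leqn0; have /andP[_ h] := interm r; rewrite (leq_trans h) // -la0E.
    exact: la_mono.
  split; last by rewrite (row_funE m (Ordinal ltNK)); have := m0 (Ordinal ltNK); rewrite /= leqnn.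
  apply/forallP => r; have [lt|ge] := ltnP r N.
    by have := okm (Ordinal lt); rewrite /= row_funE.
  have := m0 r; rewrite ge => /eqP ->; rewrite andbT -la0E; exact: la_mono.
case: (boolP (ok _)) condE => okm; rewrite ?andbT ?andbF => condE; last first.
  rewrite if_same; case: ifP condE => //= _ ->; exact: mulr0.
rewrite -condE; case: (boolP (interlace la m)) condE => //= inter condE.
case: ifP condE => [/eqP m0 /esym/forallP z0|]; last by rewrite mulr0.
rewrite mulrA; congr (_ * _); rewrite mulrC.
under eq_bigr do rewrite -row_funE.
rewrite -!(big_mkord xpredT (fun r => W r (row_fun m r))) (big_cat_nat (n := N)) //= ?(ltnW ltNK) //.
congr (_ * _); rewrite (big_ltn ltNK) [X in _ * X]big_nat [X in _ * X]big1 ?mulr1.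
  by rewrite /W /strip_weight m0 la0E ltnn subn0 expr0 mulr1.
move=> r /andP[lt ltK]; have := z0 (Ordinal ltK); rewrite /= (ltnW lt) -row_funE /= => /eqP ->.
have laz s : (N < s)%N -> la s = 0%N by move=> h; apply/eqP; rewrite -leqn0 -la0E la_mono.
by rewrite /W /strip_weight laz // laz ?(leqW lt) // !expr0 mulr1.
Qed.
End BialternantDomain.

(** * Symmetry *)

Section Specialization.
Variables (R S : comNzRingType) (phi : {rmorphism R -> S}).

Lemma tabsum_map (G : finType) (rw cl : G -> nat) M (x : 'I_M -> R) (x' : 'I_M -> S) N L :
  (forall i, phi (x i) = x' i) -> phi (tabsum rw cl x N L) = tabsum rw cl x' N L.
Proof.
move=> xx; rewrite rmorph_sum; apply: eq_bigr => t _.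
rewrite rmorph_prod; apply: eq_bigr => b _.
rewrite rmorphM rmorphXn rmorphN1 rmorph_prod; congr (_ * _).
by apply: eq_bigr => k _.
Qed.

Lemma altmx_map N (y : nat -> R) (y' : nat -> S) la :
  (forall i, (i < N)%N -> phi (y i) = y' i) -> phi (\det (altmx y N la)) = \det (altmx y' N la).
Proof.
move=> yy; rewrite -det_map_mx; congr (\det _); apply/matrixP => i j; rewrite !mxE.
by rewrite rmorphM !rmorphXn rmorphB rmorph1 yy.
Qed.

Lemma vandprod_map N (y : nat -> R) (y' : nat -> S) :
  (forall i, (i < N)%N -> phi (y i) = y' i) -> phi (vandprod y N) = vandprod y' N.
Proof.
move=> yy; rewrite rmorph_prod; apply: eq_bigr => i _; rewrite rmorph_prod.
by apply: eq_bigr => j _; rewrite rmorphB !yy // (ltn_trans (ltn_ord j)).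
Qed.
End Specialization.

Section Symmetry.
Variable M : nat.
Local Notation P := (mpoly.mpoly M int).

Definition gen_ext (T : nmodType) (f : 'I_M -> T) (i : nat) : T :=
  if insub i is Some j then f j else 0.

Lemma gen_extE (T : nmodType) (f : 'I_M -> T) (i : 'I_M) : gen_ext f i = f i.
Proof. by rewrite /gen_ext valK. Qed.

Lemma gen_ext_neq1 (R : idomainType) (f : 'I_M -> R) :
  (forall i, 1 - f i != 0) -> forall i, 1 - gen_ext f i != 0.
Proof.
move=> f1 i; rewrite /gen_ext; case: insubP => [j _ _|_]; first exact: f1.
by rewrite subr0 oner_neq0.
Qed.

(** A permutation of the variables multiplies both alternants by its sign; the
    denominator is the numerator for the empty shape. *)
Lemma tabsum_sym_domain (R : idomainType) (X : 'I_M -> R) (s : 'S_M) (la0 : intpart) la :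
  (forall i, 1 - X i != 0) -> vandprod (gen_ext X) M != 0 ->
  (forall r, (la r <= nth 0 la0 r)%N) -> (forall r, (la r.+1 <= la r)%N) ->
  tabsum (@box_row la0) (@box_col la0) (X \o s) M (diagram la0 la) =
  tabsum (@box_row la0) (@box_col la0) X M (diagram la0 la).
Proof.
move=> X1 vand_neq0 la_sh la_dec.
set tabs := tabsum (@box_row la0) (@box_col la0).
have tE (f : 'I_M -> R) : tabs _ _ f M (diagram la0 la) = tabs _ _ (fun i : 'I_M => gen_ext f i) M (diagram la0 la).
  by apply: (@tabsum_map _ _ idfun) => i; rewrite gen_extE.
rewrite (tE (X \o s)) (tE X); apply: (mulfI vand_neq0).
have alt_perm mu : \det (altmx (gen_ext (X \o s)) M mu) = (-1) ^+ s * \det (altmx (gen_ext X) M mu).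
  rewrite -det_perm -det_mulmx -row_permE; congr (\det _); apply/matrixP => i j.
  by rewrite !mxE gen_extE (gen_extE X (s i)).
have vand_det (f : 'I_M -> R) : (forall i, 1 - gen_ext f i != 0) -> vandprod (gen_ext f) M = \det (altmx (gen_ext f) M (fun=> 0%N)).
  move=> f1; have := bialternant_domain f1 (leqnn M) (fun r => leq0n (nth 0%N la0 r)) (fun=> leqnn 0).
  rewrite (_ : diagram _ _ = finset.set0) ?tabsum_set0 ?mulr1 //.
have Xs1 : forall i, 1 - gen_ext (X \o s) i != 0 by apply: gen_ext_neq1 => i; exact: X1.
have X1' := gen_ext_neq1 X1.
have vand_perm : vandprod (gen_ext (X \o s)) M = (-1) ^+ s * vandprod (gen_ext X) M.
  by rewrite (vand_det _ Xs1) (vand_det _ X1') alt_perm.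
have e1 := bialternant_domain Xs1 (leqnn M) la_sh la_dec.
have e2 := bialternant_domain X1' (leqnn M) la_sh la_dec.
apply: (@mulfI _ ((-1) ^+ s)); first by rewrite signr_eq0.
rewrite mulrA -vand_perm e1 e2; case: ifP => _; last by rewrite mulr0.
by rewrite alt_perm.
Qed.

(* Indeterminates: the formulas are polynomial identities with integer
   coefficients, so they may be proved where 1 - X i and the Vandermonde product
   can be cancelled. *)
Let X (i : 'I_M) : P := mpoly.mpolyX int (mpoly.mnm1 i).

Let X1 (i : 'I_M) : 1 - X i != 0.
Proof.
apply/eqP => /(congr1 (mpoly.mcoeff (mpoly.mnm1 i))).
rewrite raddfB /= mpoly.mcoeffXU eqxx mpoly.mcoeff1 raddf0.
by case: eqP => // /(congr1 (@mpoly.mdeg M)); rewrite mpoly.mdeg1 mpoly.mdeg0.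
Qed.

Let X1' := gen_ext_neq1 X1.

Let vand_neq0 N : (N <= M)%N -> vandprod (gen_ext X) N != 0.
Proof.
move=> leNM; rewrite /vandprod; apply/prodf_neq0 => i _; apply/prodf_neq0 => j _.
have ltiM : (i < M)%N by apply: leq_trans leNM.
have ltjM : (j < M)%N by apply: ltn_trans ltiM.
rewrite (gen_extE X (Ordinal ltiM)) (gen_extE X (Ordinal ltjM)).
apply/eqP => /(congr1 (mpoly.mcoeff (mpoly.mnm1 (Ordinal ltiM)))).
rewrite raddfB /= !mpoly.mcoeffXU eqxx raddf0 -val_eqE /= ltn_eqF //.
Qed.

Variable la0 : intpart.
Local Notation sh := (nth 0%N la0).
Local Notation tabs := (tabsum (@box_row la0) (@box_col la0)).

Lemma bialternant (S : comNzRingType) (y : nat -> S) N (la : nat -> nat) : (N <= M)%N ->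
  (forall r, (la r <= sh r)%N) -> (forall r, (la r.+1 <= la r)%N) ->
  vandprod y N * tabs (fun i : 'I_M => y i) N (diagram la0 la) =
    if la N == 0%N then \det (altmx y N la) else 0.
Proof.
move=> leNM la_sh la_dec; pose phi : {rmorphism P -> S} := mpoly.mmap (intr : int -> S) (fun i : 'I_M => y i).
have phiX (i : 'I_M) : phi (X i) = y i by rewrite /phi /= mpoly.mmapX mpoly.mmap1U.
have phiE i : (i < N)%N -> phi (gen_ext X i) = y i.
  by move=> lt; rewrite (gen_extE X (Ordinal (leq_trans lt leNM))) phiX.
have := congr1 phi (bialternant_domain X1' leNM la_sh la_dec).
rewrite rmorphM (vandprod_map phiE) (@tabsum_map _ _ phi _ _ _ _ _ (fun i : 'I_M => y i)); last first.
  by move=> i; rewrite gen_extE.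
by move=> ->; case: ifP => _; rewrite ?rmorph0 // (altmx_map _ phiE).
Qed.

Lemma tabsum_sym (S : comNzRingType) (x : 'I_M -> S) (s : 'S_M) (la : nat -> nat) :
  (forall r, (la r <= sh r)%N) -> (forall r, (la r.+1 <= la r)%N) ->
  tabs (x \o s) M (diagram la0 la) = tabs x M (diagram la0 la).
Proof.
move=> la_sh la_dec.
pose phi : {rmorphism P -> S} := mpoly.mmap (intr : int -> S) x.
have phiX (i : 'I_M) : phi (X i) = x i by rewrite /phi /= mpoly.mmapX mpoly.mmap1U.
rewrite -(tabsum_map _ _ _ _ phiX) -(@tabsum_map _ _ phi _ _ _ _ (X \o s)); last by move=> i; exact: phiX.
congr (phi _).
exact: tabsum_sym_domain X1 (vand_neq0 (leqnn M)) la_sh la_dec.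
Qed.
End Symmetry.

(** * Grothendieck polynomials *)

Lemma mseries_sum_seq (I J : choiceType) (A : set J) (r : seq J) (F : J -> mseries I) :
  uniq r -> (forall j, j \in r -> A j) -> (forall j, A j -> j \notin r -> F j = 0) ->
  mseries_sum A F = \sum_(j <- r) F j.
Proof.
move=> ur rA F0; apply/funext => m; rewrite coef_sum; apply: fsum_seq => // j Aj jr.
by rewrite F0.
Qed.

Section Boxes.
Variable la : intpart.

Lemma intpart_dec r : (nth 0 la r.+1 <= nth 0 la r)%N.
Proof.
have [lt|ge] := ltnP r.+1 (size la); last by rewrite nth_default.
have /andP[srt _] := partsP la; have tr : transitive geq by move=> ? ? ? /= h1 h2; apply: leq_trans h2 h1.
by apply: (sorted_leq_nth tr leqnn 0%N srt) => //; rewrite inE // ltnW.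
Qed.

Lemma intpart_mono r s : (r <= s)%N -> (nth 0 la s <= nth 0 la r)%N.
Proof.
move: r s; apply: (@homo_leq _ (nth 0 la) (fun a b => b <= a)%N) => //; last exact: intpart_dec.
by move=> b a c h1 h2; apply: leq_trans h2 h1.
Qed.

Lemma intpart_gt0 r : (0 < nth 0 la r)%N = (r < size la)%N.
Proof.
have [lt|ge] := ltnP r (size la); last by rewrite nth_default.
have /andP[_ n0] := partsP la; rewrite lt0n; apply: contraNneq n0 => <-; exact: mem_nth.
Qed.

Lemma sum_box (F : nat -> nat) :
  (\sum_(b : box la) F (box_row b) = \sum_(r < size la) nth 0 la r * F r)%N.
Proof.
transitivity (\sum_(r < size la) \sum_(c < nth 0 la r) F r)%N; first by rewrite sig_big_dep.
by apply: eq_bigr => r _; rewrite sum_nat_const card_ord.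
Qed.

Lemma sumn_box : sumn la = (\sum_(b : box la) 1)%N.
Proof.
rewrite (sum_box (fun=> 1%N)) sumnE (big_nth 0%N) big_mkord.
by apply: eq_bigr => r _; rewrite muln1.
Qed.

Lemma diagram_full : diagram la (nth 0%N la) = [set: box la]%SET.
Proof. by apply/setP => b; rewrite !inE box_col_lt. Qed.

Lemma svt_row_le (T : filling la) (b : box la) k :
  set_valued_tableau T -> k \in T b -> (box_row b <= k)%N.
Proof.
move=> [T0 _ Tb]; move: {2}(box_row b) (erefl (box_row b)) => r.
elim: r b k => [|r IH] b k rb kb; first by rewrite rb.
have [|b' [r' c']] := @box_exists la r (box_col b).
  by apply: leq_trans _ (intpart_dec r); rewrite -rb box_col_lt.
have /fset0Pn[y yb'] := T0 b'.
rewrite rb -r'; apply: leq_ltn_trans (IH b' y r' yb') _.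
by apply: (Tb b' b) => //; rewrite rb r'.
Qed.

End Boxes.

Lemma sumn_conj (la : intpart) : sumn (conj_part la) = sumn la.
Proof.
have le_head x : x \in (la : seq nat) -> (x <= head 0 la)%N.
  move=> /(nthP 0%N)[k _ <-]; rewrite -nth0; exact: intpart_mono.
rewrite /= /conj_seq sumnE big_map -{1}[head 0%N la]subn0 -/(index_iota 0 _) big_mkord.
under eq_bigr do rewrite -sum1_count big_mkcond.
rewrite exchange_big sumnE big_seq [RHS]big_seq; apply: eq_bigr => x /le_head le.
rewrite -(big_mkord xpredT (fun j => if (j < x)%N then 1%N else 0%N)).
rewrite (big_cat_nat (n := x)) //= [X in (_ + X)%N]big_nat [X in (_ + X)%N]big1 ?addn0.
  by rewrite big_nat (eq_bigr (fun=> 1%N)) => [|j /andP[_ ->] //]; rewrite -big_nat sum_nat_const_nat subn0 muln1.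
by move=> j /andP[h _]; rewrite ltnNge h.
Qed.

Section Groth.
Variables (I : choiceType) (la : intpart).
Implicit Types (a : nat -> mseries I).

Definition groth_term a (T : filling la) : mseries I :=
  (-1) ^+ (filling_size T - sumn la) * \prod_b \prod_(k <- T b) a k.

Lemma grothE a : groth la a = mseries_sum (@set_valued_tableau la) (groth_term a).
Proof. by []. Qed.

Lemma groth_term_prod a (T : filling la) : set_valued_tableau T ->
  groth_term a T = \prod_b ((-1) ^+ (#|` T b|.-1) * \prod_(k <- T b) a k).
Proof.
move=> [T0 _ _]; rewrite big_split /= prodrXr; congr ((-1) ^+ _ * _).
rewrite sumn_box /filling_size -sumnB => [|b _]; last by rewrite cardfs_gt0.
by apply: eq_bigr => b _; rewrite subn1.
Qed.

Lemma groth_term0 a (T : filling la) b k : k \in T b -> a k = 0 -> groth_term a T = 0.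
Proof.
move=> kb ak; rewrite /groth_term (bigD1 b) //= (bigD1_seq k) //= ?fset_uniq // ak.
by rewrite !mul0r mulr0.
Qed.

Section Finite.
Variable M : nat.
Local Notation G := (box la).

Definition fill_of (t : {ffun G -> {set 'I_M}}) : filling la :=
  [ffun b => [fset x in [seq val k | k <- enum (t b)]]%fset].

Let perm_fill t b : perm_eq (fill_of t b) [seq val k | k <- enum (t b)].
Proof.
rewrite ffunE; apply: uniq_perm; rewrite ?fset_uniq //.
  by rewrite map_inj_uniq ?enum_uniq //; exact: val_inj.
by move=> x; rewrite !inE.
Qed.

Let mem_fill t b k : (k \in fill_of t b) = [exists i in t b, val i == k].
Proof.
rewrite (perm_mem (perm_fill t b)); apply/mapP/existsP => [[i]|[i /andP[it /eqP <-]]].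
  by rewrite mem_enum => it ->; exists i; rewrite it eqxx.
by exists i; rewrite ?mem_enum.
Qed.

Let mem_fill_val t b (i : 'I_M) : (val i \in fill_of t b) = (i \in t b).
Proof.
rewrite mem_fill; apply/existsP/idP => [[j /andP[jt /eqP/val_inj <-]]|it] //.
by exists i; rewrite it eqxx.
Qed.

Let fill_inj : injective fill_of.
Proof.
move=> t t' e; apply/ffunP => b; apply/setP => i.
by rewrite -!mem_fill_val e.
Qed.

Let fill_svt t : set_valued_tableau (fill_of t) <->
  tableau (@box_row la) (@box_col la) (diagram la (nth 0%N la)) t.
Proof.
rewrite diagram_full; split=> [[T0 Tr Tb]|/asboolP[t0 tr tb]].
  apply/asboolP; split=> [b|b b' /andP[/eqP er /eqP ec] x y xb yb|b b' /andP[/eqP er /eqP ec] x y xb yb].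
  - rewrite inE; apply/set0Pn; have /fset0Pn[k] := T0 b.
    by rewrite mem_fill => /existsP[i /andP[it _]]; exists i.
  - by apply: (Tr b b' er ec); rewrite mem_fill_val.
  - by apply: (Tb b b' er ec); rewrite mem_fill_val.
split=> [b|b b' er ec x y|b b' er ec x y].
- have := t0 b; rewrite inE => /set0Pn[i it]; apply/fset0Pn; exists (val i).
  by rewrite mem_fill_val.
- rewrite !mem_fill => /existsP[i /andP[it /eqP <-]] /existsP[j /andP[jt /eqP <-]].
  by apply: (tr b b') => //; rewrite /right_of er ec !eqxx.
- rewrite !mem_fill => /existsP[i /andP[it /eqP <-]] /existsP[j /andP[jt /eqP <-]].
  by apply: (tb b b') => //; rewrite /below er ec !eqxx.
Qed.

(** With finitely many arguments only finitely many tableaux count, and the sum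
    over them is the one treated above. *)
Lemma groth_tabsum a : (forall k, (M <= k)%N -> a k = 0) ->
  groth la a = tabsum (@box_row la) (@box_col la) (fun i : 'I_M => a i) M (diagram la (nth 0%N la)).
Proof.
move=> a0; set L := diagram la _.
pose Q := [pred t : {ffun G -> {set 'I_M}} | tableau (@box_row la) (@box_col la) L t && entries_lt M t].
rewrite grothE (@mseries_sum_seq _ _ _ [seq fill_of t | t <- enum Q]).
- rewrite big_map big_enum /=; apply: eq_bigr => t /andP[tab _].
  rewrite groth_term_prod; last by apply/fill_svt.
  apply: eq_bigr => b _; rewrite (perm_big _ (perm_fill t b)) big_map big_enum /=.
  congr ((-1) ^+ _.-1 * _).
  by rewrite cardE -(size_map val) -(perm_size (perm_fill t b)).
- by rewrite map_inj_uniq ?enum_uniq //; exact: fill_inj.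
- by move=> T /mapP[t]; rewrite mem_enum => /andP[tab _] ->; apply/fill_svt.
- move=> T svt nin.
  have [lt|] := pselect (forall b k, k \in T b -> (k < M)%N); last first.
    move=> /existsNP[b] /existsNP[k] /not_implyP[kb /negP]; rewrite -leqNgt => le.
    by apply: (groth_term0 kb); apply: a0.
  case/negP: nin; apply/mapP.
  pose t : {ffun G -> {set 'I_M}} := [ffun b => [set i : 'I_M | val i \in T b]%SET].
  have TE : T = fill_of t.
    apply/ffunP => b; apply/fsetP => k; rewrite mem_fill; apply/idP/existsP => [kb|[i]].
      by exists (Ordinal (lt b k kb)); rewrite ffunE inE kb /=.
    by rewrite ffunE inE => /andP[ib /eqP <-].
  exists t => //; rewrite mem_enum; apply/andP; split; first by apply/fill_svt; rewrite -TE.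
  by apply/asboolP => b x _; exact: ltn_ord.
Qed.

End Finite.

(** The arguments are variables of a common weight d, except that some may be
    replaced by 0; N recovers the index of a variable. *)
Section GrothLead.
Variables (a : nat -> mseries I) (v : nat -> {mset I}) (D N : I -> nat) (d : nat).
Hypothesis d_gt0 : (0 < d)%N.
Hypothesis av : forall k, a k = 0 \/ [/\ a k = monom (v k), wsum D (v k) = d & wsum N (v k) = k].
Hypothesis a_nz : forall k, (k < size la)%N -> a k != 0.

Definition groth_mon : {mset I} := \big[msetD/mset0]_(b : box la) v (box_row b).

Let monom_prod (J : Type) (r : seq J) (m : J -> {mset I}) :
  \prod_(j <- r) monom (m j) = monom (\big[msetD/mset0]_(j <- r) m j).
Proof. by elim/big_rec2: _ => // j y1 y2 _ ->; rewrite monomD. Qed.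

Let term_monom (T : filling la) : set_valued_tableau T -> groth_term a T != 0 ->
  (forall b k, k \in T b -> a k = monom (v k) /\ wsum D (v k) = d /\ wsum N (v k) = k) /\
  groth_term a T = (-1) ^+ (filling_size T - sumn la) *
    monom (\big[msetD/mset0]_(b : box la) \big[msetD/mset0]_(k <- T b) v k).
Proof.
move=> svt nz; have vk b k : k \in T b -> a k = monom (v k) /\ wsum D (v k) = d /\ wsum N (v k) = k.
  move=> kb; case: (av k) => [ak|[]]; last by [].
  by rewrite (groth_term0 kb ak) eqxx in nz.
split=> //; rewrite /groth_term -monom_prod; congr (_ * _); apply: eq_bigr => b _.
rewrite -monom_prod big_seq [RHS]big_seq; apply: eq_bigr => k kb.
by have [-> _] := vk b k kb.
Qed.

(* Variables are indexed from 0, as rows are. *)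
Let T0 : filling la := [ffun b => [fset box_row b]%fset].

Let svt0 : set_valued_tableau T0.
Proof.
split=> [b|b b' er _ x y|b b' er _ x y]; rewrite !ffunE.
- by apply/fset0Pn; exists (box_row b); rewrite inE.
- by rewrite !inE er => /eqP -> /eqP ->.
- by rewrite !inE er => /eqP -> /eqP ->.
Qed.

Let term0 : groth_term a T0 = monom groth_mon.
Proof.
rewrite /groth_term (_ : filling_size T0 = sumn la); last first.
  by rewrite sumn_box; apply: eq_bigr => b _; rewrite ffunE cardfs1.
rewrite subnn expr0 mul1r /groth_mon -monom_prod; apply: eq_bigr => b _.
rewrite ffunE big_seq_fset1; case: (av (box_row b)) => [/eqP|[]//].
by rewrite (negbTE (a_nz (box_row_lt b))).
Qed.

Let wsum_mon : wsum D groth_mon = (d * sumn la)%N /\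
   wsum N groth_mon = (\sum_(b : box la) box_row b)%N.
Proof.
have vE r : (r < size la)%N -> wsum D (v r) = d /\ wsum N (v r) = r.
  by move=> lt; case: (av r) => [/eqP|[_ -> ->] //]; rewrite (negbTE (a_nz lt)).
rewrite /groth_mon !wsum_sum sumn_box big_distrr /=; split; apply: eq_bigr => b _.
  by rewrite muln1; have [-> _] := vE _ (box_row_lt b).
by have [_ ->] := vE _ (box_row_lt b).
Qed.

Let term_klt (T : filling la) m : set_valued_tableau T -> T != T0 -> groth_term a T m != 0 ->
  klt D N groth_mon m.
Proof.
move=> svt TT0 nz.
have tnz : groth_term a T != 0 by apply: contraNneq nz => ->.
have [vk tE] := term_monom svt tnz; set mT := (\big[_/_]_b _) in tE.
have mE : m = mT.
  apply: (@monom_neq0 I); apply: contraNneq nz => m0.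
  by rewrite tE -signr_odd mulr_sign; case: ifP => _; rewrite ?coefN m0 ?oppr0.
have [D0 N0] := wsum_mon.
have Tge b : (1 <= #|` T b|)%N by have [t0 _ _] := svt; rewrite cardfs_gt0.
have DE : wsum D m = (d * \sum_(b : box la) #|` T b|)%N.
  rewrite mE wsum_sum big_distrr /=; apply: eq_bigr => b _.
  rewrite wsum_sum big_seq (eq_bigr (fun=> d)) => [|k kb]; last by have [_ []] := vk b k kb.
  by rewrite -big_seq big_const_seq count_predT iter_addn_0.
have NE : wsum N m = (\sum_(b : box la) \sum_(k <- T b) k)%N.
  rewrite mE wsum_sum; apply: eq_bigr => b _.
  by rewrite wsum_sum big_seq [RHS]big_seq; apply: eq_bigr => k kb; have [_ []] := vk b k kb.
rewrite /klt D0 DE N0 NE sumn_box ltn_pmul2l // eqn_pmul2l //.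
have leS : (\sum_(b : box la) 1 <= \sum_(b : box la) #|` T b|)%N by apply: leq_sum.
rewrite leq_eqVlt in leS; case/orP: leS => [/eqP eS|->] //.
rewrite eS eqxx ltnn /=.
have T1 b : #|` T b| = 1%N.
  have := leqif_sum (fun b (_ : true) => leqif_eq (Tge b)).
  by case=> _ /esym; rewrite eS eqxx => /forallP/(_ b)/eqP <-.
have Tb b : exists2 k, T b = [fset k]%fset & (box_row b <= k)%N.
  have /eqP/cardfs1P[k E] := T1 b; exists k => //.
  by apply: (svt_row_le svt); rewrite E inE.
have Tle b : (box_row b <= \sum_(k <- T b) k)%N.
  by have [k -> le] := Tb b; rewrite big_seq_fset1.
have [le eqS] := leqif_sum (fun b (_ : true) => leqif_eq (Tle b)).
rewrite ltn_neqAle le andbT eqS; apply: contra TT0 => /forallP H.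
apply/eqP/ffunP => b; rewrite ffunE; have := H b; have [k -> _] := Tb b.
by rewrite big_seq_fset1 => /eqP ->.
Qed.

(** The entries in a row are at least its index, so the weights attain their
    minimum only for the tableau with the single entry r in each box of row r. *)
Lemma groth_lead : lead D N (groth la a) groth_mon.
Proof.
split=> [|m].
  rewrite grothE /mseries_sum (@fsum_seq _ _ _ [:: T0]) //.
  - by rewrite big_seq1 term0 /monom eqxx.
  - by move=> T; rewrite inE => /eqP ->.
  - move=> T svt; rewrite inE => TT0; apply/eqP; apply: contraT => /(term_klt svt TT0).
    by rewrite /klt !ltnn andbF.
rewrite grothE /mseries_sum => nz.
have [T [svt tnz]] : exists T, set_valued_tableau T /\ groth_term a T m != 0.
  apply: contrapT => no; move/eqP: nz; apply; apply: fsbig1 => T svt.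
  by apply/eqP; apply: contraT => tnz; case: no; exists T.
have [e|TT0] := eqVneq T T0; last by right; apply: term_klt tnz.
by left; apply: (@monom_neq0 I); rewrite -term0 -e.
Qed.

End GrothLead.

Lemma groth_val a w n : (forall k, val_ge w n (a k)) -> val_ge w (n * sumn la) (groth la a).
Proof.
move=> va; rewrite grothE; apply: val_ge_mseries_sum => T svt.
rewrite /groth_term -[(n * _)%N]add0n; apply: val_geM.
  by elim: (_ - _)%N => // k IH; rewrite exprS -[0%N]/(0 + 0)%N; apply: val_geM.
apply: (@val_geW _ _ _ (\sum_(b : box la) \sum_(k <- T b) n)%N); last first.
  by apply: val_ge_prod => b; apply: val_ge_prod.
rewrite sumn_box big_distrr; apply: leq_sum => b _ /=; rewrite big_const_seq count_predT iter_addn_0.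
by rewrite leq_mul2l; have [t0 _ _] := svt; rewrite cardfs_gt0 t0 orbT.
Qed.

(** The symmetry of Grothendieck polynomials, in a form that allows repeated
    arguments. *)
Lemma groth_perm (s1 s2 : seq (mseries I)) : perm_eq s1 s2 ->
  groth la (fun k => s1`_k) = groth la (fun k => s2`_k).
Proof.
move=> pe; have [n sz2] : exists n, size s2 = n by exists (size s2).
have sz1 : size s1 = n by rewrite (perm_size pe).
have /tuple_permP[s sE] : perm_eq s1 (tcast sz2 (in_tuple s2)) by rewrite val_tcast.
rewrite (@groth_tabsum n) => [|k le]; last by rewrite nth_default ?sz1.
rewrite (@groth_tabsum n) => [|k le]; last by rewrite nth_default ?sz2.
rewrite -(@tabsum_sym _ la _ (fun i : 'I_n => s2`_i) s) //; last exact: intpart_dec.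
congr (tabsum _ _ _ _ _); apply/funext => i /=.
rewrite sE (nth_map i) ?size_enum_ord // nth_ord_enum (tnth_nth 0).
by rewrite val_tcast.
Qed.

Lemma eq_groth a1 a2 : a1 =1 a2 -> groth la a1 = groth la a2.
Proof. by move=> /funext ->. Qed.

Lemma groth_mkseq a M : (forall k, (M <= k)%N -> a k = 0) ->
  groth la a = groth la (fun k => (mkseq a M)`_k).
Proof.
move=> a0; apply: eq_groth => k; have [lt|ge] := ltnP k M; first by rewrite nth_mkseq.
by rewrite nth_default ?size_mkseq // a0.
Qed.

Lemma act_groth (g g' : I -> I) a : cancel g g' -> cancel g' g ->
  act g (groth la a) = groth la (fun k => act g (a k)).
Proof.
move=> gK g'K; rewrite !grothE act_mseries_sum; congr mseries_sum; apply/funext => T.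
rewrite /groth_term (actM gK g'K); congr (_ * _).
  rewrite (actX gK g'K); congr (_ ^+ _).
  by rewrite actN (act1 gK g'K).
rewrite (act_prod gK g'K); apply: eq_bigr => b _; exact: (act_prod gK g'K).
Qed.

End Groth.

Section Truncation.
Variables (la : intpart) (M : nat).

Definition trunc_var k : mseries nat := if (k < M)%N then mvar k else 0.

(** A tableau with an entry outside the range of m contributes nothing at m. *)
Lemma coef_Groth_trunc (m : {mset nat}) : (forall k, k \in m -> (k < M)%N) ->
  Groth la m = groth la trunc_var m.
Proof.
move=> supp; rewrite /Groth !grothE /mseries_sum; apply: eq_fsbigr => T /set_mem svt.
have [lt|] := pselect (forall b k, k \in T b -> (k < M)%N).
  suff -> : groth_term (@mvar nat) T = groth_term trunc_var T by [].
  rewrite /groth_term; congr (_ * _); apply: eq_bigr => b _.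
  rewrite big_seq [RHS]big_seq; apply: eq_bigr => k kb.
  by rewrite /trunc_var (lt b k kb).
move=> /existsNP[b] /existsNP[k] /not_implyP[kb /negP nlt].
rewrite (groth_term0 (a := trunc_var) kb) ?/trunc_var ?(negbTE nlt) //.
apply/eqP; rewrite coef0; apply: contraT.
rewrite /groth_term (bigD1 b) //= (bigD1_seq k) //= ?fset_uniq //.
rewrite mulrCA -mulrA => /coefM_neq0[m1 [m2 [mE]]].
rewrite mvarE => /monom_neq0 m1E _; case/negP: nlt; apply: supp.
by rewrite -mE in_msetD m1E in_msetn eqxx.
Qed.

Definition perm_ext (s : 'S_M) (k : nat) : nat := if insub k is Some i then s i : nat else k.

Lemma perm_extE (s : 'S_M) (i : 'I_M) : perm_ext s i = s i.
Proof. by rewrite /perm_ext valK. Qed.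

Lemma perm_ext_ge (s : 'S_M) k : (M <= k)%N -> perm_ext s k = k.
Proof. by move=> le; rewrite /perm_ext insubN // -leqNgt. Qed.

Lemma perm_extK (s : 'S_M) : cancel (perm_ext s) (perm_ext s^-1).
Proof.
move=> k; have [lt|ge] := ltnP k M; last by rewrite !perm_ext_ge.
by rewrite (perm_extE s (Ordinal lt)) perm_extE permK.
Qed.

Lemma perm_extKV (s : 'S_M) : cancel (perm_ext s^-1) (perm_ext s).
Proof. by move=> k; have := perm_extK s^-1 k; rewrite invgK. Qed.

Lemma Groth_sym (s : 'S_M) (m : {mset nat}) : (forall k, k \in m -> (k < M)%N) ->
  Groth la (relabel (perm_ext s) m) = Groth la m.
Proof.
move=> supp; rewrite !coef_Groth_trunc //; last first.
  move=> k; rewrite (perm_mem (perm_eq_seq_mset _)) => /mapP[j jm ->].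
  by rewrite (perm_extE s (Ordinal (supp j jm))) ltn_ord.
rewrite -[LHS]/(act (perm_ext s) (groth la trunc_var) m).
rewrite (act_groth _ _ (perm_extK s) (perm_extKV s)).
have trunc0 k : (M <= k)%N -> trunc_var k = 0 by move=> le; rewrite /trunc_var ltnNge le.
rewrite (@groth_mkseq _ _ (fun k => act (perm_ext s) (trunc_var k)) M); last first.
  by move=> k le; rewrite trunc0.
rewrite [in RHS](groth_mkseq la trunc0).
suff pe : perm_eq (mkseq (fun k => act (perm_ext s) (trunc_var k)) M) (mkseq trunc_var M).
  by rewrite (groth_perm la pe).
have pe : perm_eq [seq perm_ext s^-1 k | k <- iota 0 M] (iota 0 M).
  apply: uniq_perm; rewrite ?iota_uniq //.
    by rewrite map_inj_uniq ?iota_uniq //; apply: can_inj (perm_extKV s).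
  move=> k; rewrite mem_iota; apply/mapP/andP => [[j]|[_ lt]].
    rewrite mem_iota => /andP[_ lt] ->; split=> //.
    by rewrite (perm_extE s^-1 (Ordinal lt)) ltn_ord.
  exists (perm_ext s k); last by rewrite perm_extK.
  by rewrite mem_iota (perm_extE s (Ordinal lt)) /= ltn_ord.
suff <- : [seq trunc_var j | j <- [seq perm_ext s^-1 k | k <- iota 0 M]] =
    mkseq (fun k => act (perm_ext s) (trunc_var k)) M by exact: perm_map.
rewrite -map_comp; apply/eq_in_map => k; rewrite mem_iota => /andP[_ lt].
rewrite /= /trunc_var (_ : (k < M)%N = true) // (act_mvar (perm_extK s) (perm_extKV s)).
by rewrite (perm_extE s^-1 (Ordinal lt)) ltn_ord.
Qed.

End Truncation.

(** * Expansions in Grothendieck polynomials *)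

Definition deg1 (I : choiceType) : I -> nat := fun=> 1%N.

Lemma mset_bigE (I : choiceType) (J : Type) (r : seq J) (F : J -> {mset I}) (x : I) :
  (\big[msetD/mset0]_(j <- r) F j)%mset x = (\sum_(j <- r) F j x)%N.
Proof. by elim/big_rec2: _ => [|j y1 y2 _ <-]; rewrite ?mset0E ?msetE2. Qed.

Lemma intpart_eq (la mu : intpart) : (forall k, nth 0%N la k = nth 0%N mu k) -> la = mu.
Proof.
move=> e; apply/val_inj/(@eq_from_nth _ 0%N) => //=.
apply/eqP; rewrite eqn_leq; apply/andP; split; rewrite leqNgt -intpart_gt0.
  by rewrite e intpart_gt0 ltnn.
by rewrite -e intpart_gt0 ltnn.
Qed.

Lemma intpart_of_sorted (c : seq nat) : sorted geq c ->
  exists2 la : intpart, (size la <= size c)%N & forall k, nth 0%N la k = nth 0%N c k.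
Proof.
have tr : transitive geq by move=> ? ? ? /= h1 h2; apply: leq_trans h2 h1.
move=> srt; have P : is_intpart [seq x <- c | (0 < x)%N].
  by rewrite /is_intpart sorted_filter // mem_filter.
exists (IntPart P); first by rewrite /= size_filter count_size.
move=> /=; elim: c srt {P} => //= x c IH pth k.
case: posnP => [x0|_]; last by case: k => //= k; apply: IH; apply: path_sorted pth.
have c0 y : y \in c -> y = 0%N.
  by have /allP := order_path_min tr pth => /[apply] /=; rewrite x0 leqn0 => /eqP.
have -> : [seq y <- c | (0 < y)%N] = [::].
  by apply/eqP; rewrite -size_eq0 size_filter -leqn0 leqNgt -has_count; apply/hasPn => y /c0 ->.
rewrite nth_nil; case: k => //= k; have [lt|ge] := ltnP k (size c); last by rewrite nth_default.
by rewrite (c0 (nth 0%N c k)) ?mem_nth.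
Qed.

Lemma sort_exponents n (c : 'I_n -> nat) :
  exists (s : 'S_n) (la : intpart), (size la <= n)%N /\ forall i : 'I_n, nth 0%N la i = c (s i).
Proof.
pose t := [tuple c i | i < n].
have /tuple_permP[s sE] : perm_eq (sort geq t) t by rewrite perm_sort.
have tot : total geq by move=> a b /=; apply: leq_total.
have [la la_sz laE] := intpart_of_sorted (sort_sorted tot t).
exists s, la; split; first by apply: leq_trans la_sz _; rewrite size_sort size_tuple.
by move=> i; rewrite laE sE (nth_map i) ?size_enum_ord // nth_ord_enum tnth_mktuple.
Qed.

Lemma finite_intparts n : finite_set [set la : intpart | (sumn la <= n)%N].
Proof.
pose F (b : n.-bseq 'I_n.+1) : intpart := insubd (IntPart (isT : is_intpart [::])) [seq val i | i <- b].
apply: (@sub_finite_set _ _ (F @` setT)); last exact/finite_image/finite_finset.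
move=> la /= le.
have n0 x : x \in (la : seq nat) -> (0 < x)%N.
  by have /andP[_ z] := partsP la; rewrite lt0n; apply: contraTneq => ->.
have sz : (size la <= n)%N.
  apply: leq_trans le; have := n0; elim: (la : seq nat) => //= x s IH h.
  rewrite -add1n leq_add ?h ?mem_head // IH // => y ys; apply: h; by rewrite inE ys orbT.
have szb : (size [seq inord x : 'I_n.+1 | x <- la] <= n)%N by rewrite size_map.
exists (Bseq szb) => //; apply: val_inj; rewrite /F /= -map_comp.
have -> : [seq (val \o (inord : nat -> 'I_n.+1)) x | x <- la] = la.
  rewrite -[RHS]map_id; apply/eq_in_map => x xl /=; rewrite inordK // ltnS.
  apply: leq_trans le; elim: (la : seq nat) xl => //= y s IH; rewrite inE => /predU1P[->|/IH].
    exact: leq_addr.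
  by move=> h; apply: leq_trans h _; exact: leq_addl.
by rewrite val_insubd partsP.
Qed.

(** Weights are natural numbers, so their lexicographic order is well-founded. *)
Lemma wf_klt (I : choiceType) (J : Type) (D N : I -> nat) (mon : J -> {mset I}) :
  well_founded (fun j k => klt D N (mon j) (mon k)).
Proof.
suff H n1 n2 j : (wsum D (mon j) < n1)%N -> (wsum N (mon j) < n2)%N ->
    Acc (fun j k => klt D N (mon j) (mon k)) j by move=> j; apply: (H _ _ j (ltnSn _) (ltnSn _)).
elim: n1 n2 j => [|n1 IH1] n2 j; first by rewrite ltn0.
elim: n2 j => [|n2 IH2] j h1 h2; first by rewrite ltn0 in h2.
constructor=> k /orP[lt|/andP[/eqP e lt]].
  exact: (IH1 (wsum N (mon k)).+1 k (leq_trans lt h1) (ltnSn _)).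
by apply: (IH2 k); [rewrite e | exact: leq_trans lt h2].
Qed.

Section Lambda.
Local Notation D := (@deg1 nat).
Local Notation E := (fun k : nat => k).

Definition part_mon (la : intpart) : {mset nat} := groth_mon la (fun k => [mset k]%mset).

Lemma part_monE la k : part_mon la k = nth 0%N la k.
Proof.
rewrite /part_mon /groth_mon mset_bigE.
rewrite (eq_bigr (fun b : box la => (fun r => nat_of_bool (k == r)) (box_row b))) => [|b _]; last first.
  by rewrite msetnE; case: eqP.
rewrite (sum_box la (fun r => nat_of_bool (k == r))).
have [lt|ge] := ltnP k (size la); last first.
  rewrite nth_default // big1 // => r _; rewrite gtn_eqF ?muln0 //.
  by apply: leq_trans ge.
rewrite (bigD1 (Ordinal lt)) //= eqxx muln1 big1 ?addn0 // => r.
by rewrite -val_eqE /= eq_sym => /negbTE ->; rewrite muln0.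
Qed.

Lemma part_mon_inj : injective part_mon.
Proof. by move=> la mu e; apply: intpart_eq => k; rewrite -!part_monE e. Qed.

Lemma deg_part_mon la : wsum D (part_mon la) = sumn la.
Proof.
by rewrite /part_mon /groth_mon wsum_sum sumn_box; apply: eq_bigr => b _; rewrite wsum1.
Qed.

Lemma Groth_lead la : lead D E (Groth la) (part_mon la).
Proof.
apply: (@groth_lead _ la _ (fun k : nat => [mset k]%mset) D E 1) => // k.
  by right; rewrite !wsum1.
move=> _; apply/eqP => /(congr1 (fun h : mseries nat => h [mset k]%mset)).
by rewrite mvarE /monom eqxx.
Qed.

Lemma Groth_val (la : intpart) : val_ge D (sumn la) (Groth la).
Proof.
rewrite -[sumn la]mul1n; apply: groth_val => k.
rewrite mvarE; apply: val_geW (@val_ge_monom _ D [mset k]%mset).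
by rewrite wsum1.
Qed.

Definition nat_sim (m m' : {mset nat}) : Prop :=
  exists M (s : 'S_M), (forall k, k \in m -> (k < M)%N) /\ m' = relabel (perm_ext s) m.

Lemma nat_sim_part m : exists la, nat_sim m (part_mon la).
Proof.
pose M := (\max_(k <- m) k.+1)%N.
have supp k : k \in m -> (k < M)%N by move=> km; apply: (@leq_bigmax_seq _ _ _ S).
have [s [la [sz laE]]] := sort_exponents (fun i : 'I_M => m i).
exists la, M, s^-1%g; split=> //; apply/msetP => k; rewrite part_monE.
have inj : injective (perm_ext s^-1%g) := can_inj (perm_extK _).
rewrite -[k in RHS](perm_extK s) relabelE //; have [lt|ge] := ltnP k M.
  by rewrite (perm_extE s (Ordinal lt)) -laE.
rewrite perm_ext_ge // nth_default ?(leq_trans sz) //; apply/esym/eqP; rewrite mset_eq0.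
by apply: contraL ge => /supp; rewrite -ltnNge.
Qed.

Definition Rpart (la mu : intpart) : Prop := klt D E (part_mon la) (part_mon mu).

Lemma Rpart_fin mu : finite_set [set la | Rpart la mu].
Proof.
apply: sub_finite_set (finite_intparts (sumn mu)) => la.
rewrite /= /Rpart /klt !deg_part_mon; lia.
Qed.

Let Rwf : well_founded Rpart := wf_klt D E part_mon.
Let Gmon la : Groth la (part_mon la) = 1. Proof. by have [] := Groth_lead la. Qed.
Let Gtri la mu : Groth la (part_mon mu) != 0 -> la = mu \/ Rpart la mu.
Proof. by move=> /(proj2 (Groth_lead la))[/part_mon_inj|]; [left|right]. Qed.
Let Gsim la m m' : nat_sim m m' -> Groth la m = Groth la m'.
Proof. by move=> [M [s [supp ->]]]; rewrite Groth_sym. Qed.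

Lemma groth_prod_sim la mu m m' : nat_sim m m' ->
  (Groth la * Groth mu) m = (Groth la * Groth mu) m'.
Proof.
move=> [M [s [supp ->]]].
rewrite -[RHS]/(act (perm_ext s) (Groth la * Groth mu) m).
rewrite (actM (perm_extK s) (perm_extKV s)).
have sub a : (a `<=` m)%mset -> forall k, k \in a -> (k < M)%N.
  by move=> le k /(msubset_subset le); apply: supp.
by apply: eq_coefM => a /sub sa; rewrite /act Groth_sym.
Qed.

(** Products of symmetric series are symmetric, so the expansion by which the
    coefficients are defined does exist. *)
Lemma groth_c_sums la mu :
  sums_to setT (fun nu => Groth nu *~ groth_c la mu nu) (Groth la * Groth mu).
Proof.
rewrite /groth_c; case: xgetP => [c _ //|no].
have [c [cP _]] := @triangular_expansion _ _ nat_sim part_mon Groth Rpart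
  Rwf Rpart_fin Gmon Gtri nat_sim_part Gsim _ (@groth_prod_sim la mu).
by case: (no c).
Qed.

(** The lowest degree of an expansion is that of the product. *)
Lemma groth_c_small la mu nu : groth_c la mu nu != 0 -> (sumn la + sumn mu <= sumn nu)%N.
Proof.
apply: contraNT; rewrite -ltnNge => lt; apply/eqP.
have /(sums_to_triangular Rwf Rpart_fin Gmon Gtri nat_sim_part Gsim _ (@groth_prod_sim la mu)) H
  := groth_c_sums la mu.
elim/(well_founded_ind Rwf): nu lt => nu IH lt.
have := H nu; rewrite (@val_ge_coef _ D _ _ _ (val_geM (@Groth_val la) (@Groth_val mu))) ?deg_part_mon //.
rewrite big_seq big1 ?addr0 => [<- //|tau].
rewrite [tau \in _](_ : _ = (tau \in fset_set [set la | Rpart la nu])) //.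
rewrite in_fset_set ?inE; last exact: Rpart_fin.
move=> /[dup] R /IH ->; rewrite ?mulr0 //.
by move: R; rewrite /= /Rpart /klt !deg_part_mon; lia.
Qed.

End Lambda.

(** * Extracting coefficients with alternants *)

Section Alternants.
Local Notation D := (@deg1 nat).
Local Notation S := (mseries nat).
Local Notation y := (@mvar nat).

Definition alternant N (al : nat -> nat) : S := \det (\matrix_(i < N, j < N) (y i ^+ al j)).

(** The largest exponent goes to the last variable: then an expansion along the
    first column of an alternant removes the last variable and leaves an
    alternant in x_0, ..., x_(N-1). *)
Definition rev_mon N (be : nat -> nat) : {mset nat} :=
  \big[msetD/mset0]_(i < N) msetn (be (N.-1 - i)%N) (i : nat).

Lemma monomX (I : choiceType) (k : I) n : mvar k ^+ n = monom (msetn n k).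
Proof.
elim: n => [|n IH]; first by rewrite expr0 msetn0.
rewrite exprS IH mvarE -monomD; congr monom; apply/msetP => x; rewrite msetE2 !msetnE.
by case: eqP.
Qed.

Lemma rev_monE N be k : rev_mon N be k = if (k < N)%N then be (N.-1 - k)%N else 0%N.
Proof.
rewrite /rev_mon mset_bigE; case: ltnP => [lt|ge].
  rewrite (bigD1 (Ordinal lt)) //= msetnxx big1 ?addn0 // => i.
  by rewrite -val_eqE /= msetnE eq_sym => /negbTE ->.
by rewrite big1 // => i _; rewrite msetnE gtn_eqF // (leq_trans _ ge).
Qed.

Lemma wsum_msetn (I : choiceType) (w : I -> nat) n k : wsum w (msetn n k) = (n * w k)%N.
Proof. by rewrite /wsum enum_msetn big_nseq iter_addn_0 mulnC. Qed.

Lemma deg_rev_mon N be : wsum D (rev_mon N be) = (\sum_(j < N) be j)%N.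
Proof.
rewrite /rev_mon wsum_sum (reindex_inj rev_ord_inj); apply: eq_bigr => i _ /=.
by rewrite wsum_msetn muln1; congr be; have := ltn_ord i; lia.
Qed.

(** The sign of the permutation that reverses n indices. *)
Definition eps n : int := \prod_(t < n) (-1) ^+ t.

Lemma eps_neq0 n : eps n != 0.
Proof. by apply/prodf_neq0 => i _; rewrite signr_eq0. Qed.

(** If the largest exponent of the alternant is that of the last variable in m,
    and exceeds all other exponents in m, only one term of the expansion along
    the first column contributes. *)
Lemma alternant_step N al (H : S) (m : {mset nat}) :
  m N = al 0%N -> (forall i, (i < N)%N -> (m i < al 0)%N) ->
  (alternant N.+1 al * H) m =
  (-1) ^+ N * (alternant N (fun j => al j.+1) * H) (m `\` msetn (al 0%N) N)%mset.
Proof.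
move=> mN mlt; rewrite /alternant (expand_det_col _ ord0) mulr_suml coef_sum.
rewrite big_ord_recr /= big1 ?add0r => [|i _]; last first.
  have nle : (msetn (al 0%N) (i : nat) `<=` m)%mset = false.
    apply/negP => /msubsetP/(_ (i : nat)).
    rewrite msetnxx leqNgt.
    by rewrite (mlt i (ltn_ord i)).
  rewrite mxE.
  rewrite [X in X * _ * _]monomX.
  rewrite -mulrA.
  rewrite coef_monomM.
  by rewrite nle.
have le : (msetn (al 0%N) N `<=` m)%mset.
  apply/msubsetP => k; rewrite msetnE.
  by case: (k =P N) => // ->; rewrite mN.
rewrite mxE.
rewrite [X in X * _ * _]monomX.
rewrite -mulrA.
rewrite coef_monomM.
rewrite le.
rewrite /cofactor /= addn0.
rewrite -mulrA.
rewrite -[in LHS]signr_odd -[in RHS]signr_odd.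
rewrite !mulr_sign.
set B := row' _ _.
have -> : \det B = \det (\matrix_(i < N, j < N) (y i ^+ al j.+1)).
  by congr (\det _); apply/matrixP => i j; rewrite !mxE lift_max.
by case: ifP => _; rewrite ?coefN.
Qed.

Definition sdec N (be : nat -> nat) := forall i j, (i < j)%N -> (j < N)%N -> (be j < be i)%N.

(** As long as the exponents of the alternant agree with those of the monomial,
    variables can be removed one by one. *)
Lemma alternant_peel p k al be (H : S) :
  (forall j, (j < p)%N -> al j = be j) -> sdec (p + k) be ->
  eps k * (alternant (p + k) al * H) (rev_mon (p + k) be) =
  eps (p + k) * (alternant k (fun j => al (p + j)%N) * H) (rev_mon k (fun j => be (p + j)%N)).
Proof.
elim: p al be => [|p IH] al be eqp dec; first by [].
rewrite addSn alternant_step; last first.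
- move=> i lt; rewrite rev_monE ltnS (ltnW lt) eqp //.
  by apply: dec; rewrite /= ?addSn; lia.
- by rewrite rev_monE ltnSn subnn eqp.
rewrite (_ : (rev_mon _ be `\` _)%mset = rev_mon (p + k) (fun j => be j.+1)); last first.
  apply/msetP => i; rewrite msetE2 !rev_monE msetnE ltnS.
  have [lt|ge] := ltnP i (p + k).
    by rewrite (ltnW lt) ltn_eqF // subn0 /=; congr be; lia.
  case: eqP => [->|ne]; last by rewrite ifF //; apply/negbTE; lia.
  by rewrite leqnn subnn eqp // subnn.
rewrite mulrCA IH => [|j lt|i j lt ltj]; [|exact: eqp|by apply: dec; rewrite // addSn].
by rewrite /eps big_ord_recr /= -!/(eps _) mulrCA mulrA.
Qed.

Lemma sdec_uniq N al be (s : 'S_N) : sdec N al -> sdec N be ->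
  (forall j : 'I_N, be j = al (s j)) -> forall j, (j < N)%N -> be j = al j.
Proof.
move=> da db e j lt.
have srt ga : sdec N ga -> sorted gtn (mkseq ga N).
  move=> dg; rewrite /mkseq sorted_map; apply: (@sub_in_sorted _ (mem (iota 0 N)) ltn).
  - by move=> a b; rewrite !mem_iota /= => _ lb ab; apply: dg.
  - by apply/allP.
  - exact: iota_ltn_sorted.
have eqS : mkseq be N = mkseq al N.
  apply: (@irr_sorted_eq _ gtn); rewrite ?srt //.
  - by move=> a b c /= h1 h2; apply: ltn_trans h2 h1.
  - by move=> a /=; rewrite ltnn.
  move=> x; apply/mapP/mapP => -[i]; rewrite mem_iota => /andP[_ lti] ->.
    exists (s (Ordinal lti) : nat); first by rewrite mem_iota /= ltn_ord.
    exact: (e (Ordinal lti)).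
  exists (s^-1%g (Ordinal lti) : nat); first by rewrite mem_iota /= ltn_ord.
  by rewrite e permKV.
by rewrite -(nth_mkseq 0%N be lt) eqS nth_mkseq.
Qed.

(** If the exponents agree, all variables can be removed.  Otherwise no term of
    the determinant is equal to the monomial, since two strictly decreasing
    sequences that are permutations of each other coincide. *)
Lemma alternant_coef N al be : sdec N al -> sdec N be ->
  alternant N al (rev_mon N be) =
  if [forall j : 'I_N, al j == be j] then eps N else 0.
Proof.
move=> da db; case: ifP => [/forallP e|/negbT/forallPn[j0 ne]].
  have := @alternant_peel N 0 al be 1 (fun j lt => eqP (e (Ordinal lt))); rewrite !addn0.
  move=> /(_ db); rewrite !mulr1 /eps big_ord0 mul1r => ->.
  by rewrite /alternant det_mx00 /rev_mon big_ord0 coef1 eqxx mulr1.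
rewrite /alternant /determinant coef_sum big1 // => s _.
rewrite -signr_odd mulr_sign -[RHS]/((0 : S) (rev_mon N be)).
have -> : \prod_(i < N) (\matrix_(i < N, j < N) (y i ^+ al j)) i (s i) =
    monom (\big[msetD/mset0]_(i < N) msetn (al (s i)) (i : nat)).
  transitivity (\prod_(i < N) monom (msetn (al (s i)) (i : nat))).
    by apply: eq_bigr => i _; rewrite mxE monomX.
  by elim/big_rec2: _ => // i m1 m2 _ ->; rewrite monomD.
suff z : monom (\big[msetD/mset0]_(i < N) msetn (al (s i)) (i : nat)) (rev_mon N be) = 0.
  by case: ifP => _; rewrite ?coefN z.
apply/eqP; apply: contraNT ne => /monom_neq0 e.
apply/eqP/esym; apply: (@sdec_uniq N al be (perm rev_ord_inj * s)%g) => // j.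
have := congr1 (fun m : {mset nat} => m (rev_ord j : nat)) e.
rewrite rev_monE /= mset_bigE (bigD1 (rev_ord j)) //= msetnxx big1 => [|i]; last first.
  by rewrite -val_eqE /= msetnE eq_sym => /negbTE ->.
rewrite addn0 permM permE ifT; last by have := ltn_ord j; lia.
by move=> <-; congr be; have := ltn_ord j; lia.
Qed.

End Alternants.

Section LowDegree.
Local Notation D := (@deg1 nat).
Local Notation S := (mseries nat).
Local Notation y := (@mvar nat).

Definition stair N (la : nat -> nat) j : nat := (la j + (N.-1 - j))%N.

Lemma sdec_stair N la : (forall i j, (i <= j)%N -> (la j <= la i)%N) -> sdec N (stair N la).
Proof. by move=> mono i j ij jN; have := mono i j (ltnW ij); rewrite /stair; lia. Qed.

Let val_mvarX i n : val_ge D n (y i ^+ n).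
Proof. by rewrite monomX -[n in val_ge _ n]muln1; have := @val_ge_monom _ D (msetn n i); rewrite wsum_msetn. Qed.

(* Powers and products of the 1 - y i have constant term 1. *)
Let low_unit_pow i n : val_ge D 1 ((1 - y i) ^+ n - 1).
Proof.
elim: n => [|n IH]; first by rewrite expr0 subrr => m; rewrite coef0 eqxx.
rewrite exprS (_ : _ - 1 = ((1 - y i) ^+ n - 1) + (- (y i * (1 - y i) ^+ n))); last by ring.
move=> m; rewrite coefD => nz; case: (eqVneq (((1 - y i) ^+ n - 1) m) 0) => [z|/IH //].
move: nz; rewrite z add0r; apply: (val_geN (n := 1 + 0)); apply: val_geM => //.
by rewrite -[y i]expr1; apply: val_mvarX.
Qed.

Lemma val_geD w n (f g : S) : val_ge w n f -> val_ge w n g -> val_ge w n (f + g).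
Proof.
move=> vf vg m; rewrite coefD; have [z|/vf //] := eqVneq (f m) 0.
by rewrite z add0r => /vg.
Qed.

Let low_unit_prod (J : Type) (r : seq J) (F : J -> S) :
  (forall j, val_ge D 1 (F j - 1)) -> val_ge D 1 (\prod_(j <- r) F j - 1).
Proof.
move=> vF; elim: r => [|j r IH]; first by rewrite big_nil subrr => m; rewrite coef0 eqxx.
rewrite big_cons (_ : _ - 1 = (F j - 1) * (\prod_(j <- r) F j - 1) + ((F j - 1) + (\prod_(j <- r) F j - 1))); last by ring.
apply: val_geD; last exact: val_geD.
by apply: (@val_geW _ _ _ (1 + 1)) => //; apply: val_geM.
Qed.

Let sum_perm N (s : 'S_N) (F : nat -> nat) : (\sum_(i < N) F (s i) = \sum_(i < N) F i)%N.
Proof. by rewrite [RHS](reindex_inj (@perm_inj _ s)). Qed.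

(** The factors 1 - y i only contribute terms of higher degree. *)
Lemma altmx_low N (la : nat -> nat) :
  val_ge D (\sum_(j < N) stair N la j + 1) (\det (altmx y N la) - alternant N (stair N la)).
Proof.
rewrite /alternant /determinant -sumrB; apply: val_ge_sum => s _.
rewrite -mulrBr -signr_odd mulr_sign.
suff v : val_ge D (\sum_(j < N) stair N la j + 1)
   (\prod_i altmx y N la i (s i) - \prod_i (\matrix_(i < N, j < N) (y i ^+ stair N la j)) i (s i)).
  by case: ifP => _ //; exact: val_geN.
have -> : \prod_(i < N) altmx y N la i (s i) =
    (\prod_(i < N) y i ^+ stair N la (s i)) * \prod_(i < N) (1 - y i) ^+ (s i : nat).
  by rewrite -big_split; apply: eq_bigr => i _; rewrite mxE.
have -> : \prod_(i < N) (\matrix_(i < N, j < N) (y i ^+ stair N la j)) i (s i) =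
    (\prod_(i < N) y i ^+ stair N la (s i)) * 1.
  by rewrite mulr1; apply: eq_bigr => i _; rewrite mxE.
rewrite -mulrBr; apply: val_geM.
  by rewrite -(sum_perm s (stair N la)); apply: val_ge_prod.
by apply: low_unit_prod => i; apply: low_unit_pow.
Qed.

Lemma altmxM_low N (la : nat -> nat) h (H : S) m : val_ge D h H ->
  wsum D m = (\sum_(j < N) stair N la j + h)%N ->
  (\det (altmx y N la) * H) m = (alternant N (stair N la) * H) m.
Proof.
move=> vH dm; apply/eqP; rewrite -subr_eq0.
rewrite -[X in X == _]/((\det (altmx y N la) * H - alternant N (stair N la) * H) m) -mulrBl.
apply/eqP/(val_ge_coef (val_geM (@altmx_low N la) vH)).
by rewrite dm; lia.
Qed.

Lemma vand_Groth N (tau : intpart) m : (forall k, k \in m -> (k < N)%N) ->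
  (vandprod y N * Groth tau) m = if nth 0%N tau N == 0%N then \det (altmx y N (nth 0%N tau)) m else 0.
Proof.
move=> supp; transitivity ((vandprod y N * groth tau (trunc_var N)) m).
  apply: eq_coefM => // a le; apply: coef_Groth_trunc => k ka.
  by apply: supp; apply: (msubset_subset le).
rewrite (@groth_tabsum _ _ N) => [|k le]; last by rewrite /trunc_var ltnNge le.
rewrite (_ : (fun i : 'I_N => trunc_var N i) = (fun i : 'I_N => y i)); last first.
  by apply/funext => i; rewrite /trunc_var ltn_ord.
rewrite (bialternant y (leqnn N)) //; first by case: ifP.
exact: intpart_dec.
Qed.

Lemma supp_rev_mon N be k : k \in rev_mon N be -> (k < N)%N.
Proof. by rewrite -mset_neq0 rev_monE; case: ltnP. Qed.

Lemma vandE N : vandprod y N = \det (altmx y N (fun=> 0%N)).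
Proof.
pose e : intpart := IntPart (isT : is_intpart [::]).
have := @bialternant N e S y N (fun=> 0%N) (leqnn N) (fun=> leq0n _) (fun=> leqnn _).
rewrite (_ : diagram _ _ = finset.set0) ?tabsum_set0 ?mulr1 ?eqxx //.
Qed.

Lemma alternant_val N (al : nat -> nat) : val_ge D (\sum_(j < N) al j) (alternant N al).
Proof.
rewrite /alternant /determinant; apply: val_ge_sum => s _; rewrite -signr_odd mulr_sign.
have v : val_ge D (\sum_(j < N) al j) (\prod_i (\matrix_(i < N, j < N) (y i ^+ al j)) i (s i)).
  rewrite -(sum_perm s al); apply: val_ge_prod => i; rewrite mxE; exact: val_mvarX.
by case: ifP => _ //; exact: val_geN.
Qed.

Lemma sumn_nth N (la : intpart) : (size la <= N)%N -> (\sum_(j < N) nth 0%N la j = sumn la)%N.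
Proof.
move=> sz; rewrite sumnE (big_nth 0%N) -[LHS](big_mkord xpredT (nth 0%N la)).
rewrite (big_cat_nat (n := size la)) //= [X in (_ + X)%N]big_nat [X in (_ + X)%N]big1 ?addn0 //.
by move=> j /andP[h _]; rewrite nth_default.
Qed.

Lemma sum_stair N (la : intpart) : (size la <= N)%N ->
  (\sum_(j < N) stair N (nth 0%N la) j = \sum_(j < N) stair N (fun=> 0%N) j + sumn la)%N.
Proof.
move=> sz; rewrite -(sumn_nth sz) addnC -big_split; apply: eq_bigr => j _.
by rewrite /stair add0n.
Qed.

(** Multiplying by the Vandermonde product turns the lowest form of Groth tau,
    a Schur polynomial, into an alternant, which is detected by one coefficient. *)
Lemma vand_Groth_low N (tau rho : intpart) : (size rho <= N)%N -> sumn tau = sumn rho ->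
  (vandprod y N * Groth tau) (rev_mon N (stair N (nth 0%N rho))) = if tau == rho then eps N else 0.
Proof.
move=> szN eqs; rewrite vand_Groth; last exact: supp_rev_mon.
case: eqP => [tN|tN]; last first.
  case: eqP => // e; case: tN; rewrite e nth_default //.
have szt : (size tau <= N)%N by rewrite leqNgt -intpart_gt0 tN.
have dm : wsum D (rev_mon N (stair N (nth 0%N rho))) = (\sum_(j < N) stair N (nth 0%N tau) j + 0)%N.
  by rewrite addn0 deg_rev_mon !sum_stair // eqs.
have := altmxM_low (@val_ge1 _ D) dm; rewrite !mulr1 => ->.
rewrite alternant_coef; first last.
- by apply: sdec_stair; exact: intpart_mono.
- by apply: sdec_stair; exact: intpart_mono.
congr (if _ then _ else _); apply/forallP/eqP => [e|-> j]; last exact: eqxx.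
apply: intpart_eq => k; have [lt|ge] := ltnP k N.
  by have /eqP := e (Ordinal lt); rewrite /stair /=; lia.
by rewrite !nth_default // (leq_trans _ ge).
Qed.

End LowDegree.

Definition part0 : intpart := IntPart (isT : is_intpart [::]).

Lemma sumn_rho la mu : sumn (rho_part la mu) = (sumn (rect_part la mu) + sumn la + sumn mu)%N.
Proof.
have -> : sumn (rho_part la mu) =
    (\sum_(i < rect_rows la mu) (rect_cols la mu + nth 0%N mu i) + sumn la)%N.
  by rewrite /= /rho_seq sumn_cat sumnE big_map -{1}[rect_rows la mu]subn0 -/(index_iota 0 _) big_mkord.
rewrite big_split /= sum_nat_const card_ord /rect_seq sumn_nseq sumn_nth //.
  by rewrite mulnC -addnA [(sumn mu + _)%N]addnC addnA.
by rewrite /rect_rows leq_maxr.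
Qed.

Lemma groth_d_small nu la mu : groth_d nu la mu != 0 -> (sumn nu <= sumn la + sumn mu)%N.
Proof. by move=> /groth_c_small; rewrite sumn_rho; lia. Qed.

Section GrothDelta.
Local Notation D := (@deg1 nat).
Local Notation S := (mseries nat).
Local Notation y := (@mvar nat).

(** In the expansion of a product, terms of higher degree do not contribute to
    this coefficient, and among those of lowest degree only rho contributes. *)
Lemma groth_c_extract (la mu rho : intpart) N : (size rho <= N)%N ->
  (sumn rho = sumn la + sumn mu)%N ->
  (vandprod y N * (Groth la * Groth mu)) (rev_mon N (stair N (nth 0%N rho))) =
  eps N * groth_c la mu rho.
Proof.
move=> szN eqs; set m := rev_mon _ _.
have [_ sumE] := groth_c_sums la mu; set c := groth_c la mu in sumE *.
pose L : seq intpart := fset_set [set tau : intpart | (sumn tau <= wsum D m)%N].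
have memL tau : (tau \in L) = (sumn tau <= wsum D m)%N.
  rewrite /L [LHS](_ : _ = (tau \in fset_set [set tau : intpart | (sumn tau <= wsum D m)%N])) //.
  rewrite in_fset_set; last exact: finite_intparts.
  by apply/idP/idP; rewrite inE.
have uL : uniq L by exact: fset_uniq.
transitivity ((vandprod y N * \sum_(tau <- L) Groth tau *~ c tau) m).
  apply: eq_coefM => // a le; rewrite -sumE /mseries_sum coef_sum.
  apply: fsum_seq => // tau _; rewrite memL -ltnNge => lt.
  apply: (@val_ge_coef _ D (sumn tau)); first by apply: val_geMz; exact: Groth_val.
  apply: leq_ltn_trans lt; rewrite /wsum !big_const_seq !count_predT !iter_addn_0 !mul1n.
  by rewrite -(msetBDKC le) (perm_size (perm_msetD _ _)) size_cat leq_addr.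
rewrite mulr_sumr coef_sum.
have dm : wsum D m = (\sum_(j < N) stair N (fun=> 0%N) j + sumn rho)%N.
  by rewrite /m deg_rev_mon sum_stair.
have rhoL : rho \in L by rewrite memL dm leq_addl.
rewrite (bigD1_seq rho) //= mulrzAr coefMz (vand_Groth_low szN (erefl _)) eqxx.
rewrite big_seq_cond big1 ?addr0 // => tau /andP[tauL tr].
rewrite mulrzAr coefMz; have [->|/groth_c_small le] := eqVneq (c tau) 0; first by rewrite mulr0.
have [e|ne] := eqVneq (sumn tau) (sumn rho).
  by rewrite /m (vand_Groth_low szN e) (negbTE tr) mul0r.
have vV : val_ge D (\sum_(j < N) stair N (fun=> 0%N) j) (vandprod y N).
  rewrite vandE (_ : \det _ = (\det (altmx y N (fun=> 0%N)) - alternant N (stair N (fun=> 0%N))) + alternant N (stair N (fun=> 0%N))); last by ring.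
  apply: val_geD; last exact: alternant_val.
  by apply: val_geW (@altmx_low N _); rewrite leq_addr.
rewrite (val_ge_coef (val_geM vV (@Groth_val tau))) ?mul0r //.
by rewrite dm ltn_add2l; lia.
Qed.

(** Here rho is the rectangle R with la placed below it.  In the coefficient that
    extracts rho from Groth R * Groth nu, the p largest exponents of the monomial
    are those of the alternant of R, so that p variables can be removed.  What
    remains is the coefficient that extracts la from Groth nu. *)
Lemma groth_d_delta (nu la : intpart) : sumn la = sumn nu ->
  groth_d nu la part0 = (la == nu)%:R.
Proof.
move=> eqs; rewrite /groth_d.
set R := rect_part la part0; set rho := rho_part la part0.
pose p := size la; pose q := head 0%N la.
have rE : rect_rows la part0 = p by rewrite /rect_rows maxn0.
have cE : rect_cols la part0 = q by rewrite /rect_cols maxn0.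
have Rn j : nth 0%N R j = if (j < p)%N then q else 0%N by rewrite /R /= /rect_seq rE cE nth_nseq.
have rhon j : nth 0%N rho j = if (j < p)%N then q else nth 0%N la (j - p).
  rewrite /rho /= /rho_seq rE cE nth_cat size_mkseq; case: ltnP => // lt.
  by rewrite nth_mkseq // nth_nil addn0.
have szrho : (size rho <= p + p)%N.
  by rewrite /rho /= /rho_seq size_cat size_mkseq rE.
have srho : (sumn rho = sumn R + sumn nu)%N by rewrite sumn_rho -/R -eqs addn0.
(* R and la have at most p rows each, so 2 p variables suffice. *)
have H1 := groth_c_extract szrho srho.
set m := rev_mon _ _ in H1.
have suppm k : k \in m -> (k < p + p)%N by exact: supp_rev_mon.
have szR : (size R <= p + p)%N by rewrite /R /= /rect_seq size_nseq rE leq_addr.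
have H2 : (vandprod y (p + p) * (Groth R * Groth nu)) m =
   (alternant (p + p) (stair (p + p) (nth 0%N R)) * Groth nu) m.
  rewrite mulrA; transitivity ((\det (altmx y (p + p) (nth 0%N R)) * Groth nu) m).
    apply: eq_coefM => // a le; rewrite vand_Groth ?nth_default ?eqxx //.
    by move=> k ka; apply: suppm; apply: (msubset_subset le).
  apply: altmxM_low; first exact: Groth_val.
  by rewrite /m deg_rev_mon !sum_stair // srho addnA.
have H3 := @alternant_peel p p (stair (p + p) (nth 0%N R)) (stair (p + p) (nth 0%N rho)) (Groth nu).
have k1 j : (j < p)%N -> stair (p + p) (nth 0%N R) j = stair (p + p) (nth 0%N rho) j.
  by move=> lt; rewrite /stair Rn rhon lt.
have {}H3 := H3 k1 (sdec_stair (@intpart_mono rho)).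
rewrite -/m -H2 H1 in H3.
have e1 : alternant p (fun j => stair (p + p) (nth 0%N R) (p + j)%N) = alternant p (stair p (fun=> 0%N)).
  rewrite /alternant; congr (\det _); apply/matrixP => i j; rewrite !mxE; congr (_ ^+ _).
  by rewrite /stair Rn ifF; [have := ltn_ord j; lia | lia].
have e2 : rev_mon p (fun j => stair (p + p) (nth 0%N rho) (p + j)%N) = rev_mon p (stair p (nth 0%N la)).
  apply/msetP => k; rewrite !rev_monE; case: ltnP => // lt.
  by rewrite /stair rhon ifF; [rewrite addKn; lia | lia].
rewrite e1 e2 -(altmxM_low (@Groth_val nu)) in H3; last first.
  by rewrite deg_rev_mon sum_stair // eqs.
rewrite -vandE (vand_Groth_low (leqnn p) (esym eqs)) in H3.
apply: (mulfI (eps_neq0 p)); apply: (mulfI (eps_neq0 (p + p))).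
rewrite mulrCA H3 eq_sym; case: eqP => _; by rewrite ?mulr1 ?mulr0.
Qed.
End GrothDelta.

(** * Heights of vertices *)

Section Height.
Variables (n : nat) (Q : quiver n).
Hypothesis acyclicQ : acyclic Q.

(** The number of vertices reachable from i; in a quiver without oriented cycles
    it strictly decreases along arrows. *)
Definition height (i : 'I_n) : nat := #|[pred j | connect (adjacent Q) i j]|.

Lemma height_gt0 i : (0 < height i)%N.
Proof. by apply/card_gt0P; exists i; rewrite inE connect0. Qed.

Lemma height_arrow (a : arrow Q) : (height (qhead a) < height (qtail a))%N.
Proof.
have adj : adjacent Q (qtail a) (qhead a) by apply/existsP; exists a; rewrite !eqxx.
apply: proper_card; apply/properP; split.
  by apply/fintype.subsetP => j; rewrite !inE; apply: connect_trans; exact: connect1.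
exists (qtail a); first by rewrite inE connect0.
rewrite inE; apply/negP => /connectP[p pth lst].
by have := @acyclicQ (qhead a :: p); rewrite /= rcons_path pth -lst adj => /(_ isT).
Qed.
End Height.

(** * Symmetry in the coordinate lines *)

Section TorusAction.
Variables (n : nat) (e : 'I_n -> nat).
Local Notation I := (torus_coord e).
Local Notation coord i j := (Tagged (fun v => 'I_(e v)) (j : 'I_(e i)) : I).

Definition coord_perm (s : forall i, 'S_(e i)) (k : I) : I := coord (tag k) (s (tag k) (tagged k)).

Lemma coord_permK (s s' : forall i, 'S_(e i)) :
  (forall i, cancel (s i) (s' i)) -> cancel (coord_perm s) (coord_perm s').
Proof. by move=> sK [i j]; rewrite /coord_perm /= sK. Qed.

Variable s : forall i, 'S_(e i).
Let s' i := ((s i)^-1)%g.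
Let g := coord_perm s.
Let g' := coord_perm s'.
Let gK : cancel g g'. Proof. by apply: coord_permK => i; exact: permK. Qed.
Let g'K : cancel g' g. Proof. by apply: coord_permK => i; exact: permKV. Qed.

Lemma act_class_line k : act g (class_line k) = class_line (g' k).
Proof.
rewrite /class_line act_mseries_sum; congr mseries_sum; apply/funext => p.
by rewrite (actX gK g'K) (act_mvar gK g'K).
Qed.

Lemma act_class_line_exp k z : act g (class_line_exp k z) = class_line_exp (g' k) z.
Proof.
case: z => p /=; rewrite (actX gK g'K); first by rewrite act_class_line.
by rewrite -(act_mvar gK g'K); congr (_ ^+ _); exact: (act_1B gK g'K).
Qed.

Lemma act_weight_class w : act g (weight_class w) = weight_class (permute s w).
Proof.
rewrite /weight_class (act_prod gK g'K) (reindex_inj (can_inj gK)).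
by apply: eq_bigr => k _; rewrite act_class_line_exp gK ffunE.
Qed.

Lemma permute_line k : permute s (line k) = line (g' k).
Proof.
apply/ffunP => l; rewrite !ffunE -/(coord_perm s l) -/g; congr (Posz (nat_of_bool _)).
by apply/eqP/eqP => [<-|->]; rewrite ?gK ?g'K.
Qed.

Lemma permuteN w : permute s (- w) = - permute s w.
Proof. by apply/ffunP => l; rewrite !ffunE. Qed.

Lemma act_grothU nu U : perm_eq [seq permute s w | w <- U] U ->
  act g (grothU nu U) = grothU nu U.
Proof.
move=> pe; rewrite /grothU (act_groth _ _ gK g'K).
have pe' := perm_map (fun w => 1 - weight_class (- w)) pe.
rewrite -(groth_perm nu pe'); apply: eq_groth => k.
rewrite -map_comp; have [lt|ge] := ltnP k (size U); last first.
  by rewrite !nth_default ?size_map // act0.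
rewrite !(nth_map 0) //; move: U`_k => w /=.
by rewrite -permuteN -act_weight_class; exact: (act_1B gK g'K).
Qed.

Lemma perm_repE i : perm_eq [seq permute s w | w <- repE e i] (repE e i).
Proof.
rewrite /repE -map_comp.
have -> : [seq (permute s \o (fun j => line (coord i j))) j | j <- enum 'I_(e i)] =
    [seq line (coord i j) | j <- [seq s' i j | j <- enum 'I_(e i)]].
  by rewrite -[RHS]map_comp; apply/eq_in_map => j _ /=; rewrite permute_line.
apply: perm_map; apply: uniq_perm; rewrite ?enum_uniq //.
  by rewrite map_inj_uniq ?enum_uniq //; exact: perm_inj.
move=> j; rewrite mem_enum; apply/mapP; exists (s i j); rewrite ?mem_enum //.
by rewrite permK.
Qed.

Lemma perm_repM Q i : perm_eq [seq permute s w | w <- repM e Q i] (repM e Q i).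
Proof.
rewrite /repM map_flatten -map_comp; elim: [seq a <- _ | _] => //= a r IH.
exact: perm_cat (perm_repE _) IH.
Qed.

Lemma perm_dual U : perm_eq [seq permute s w | w <- U] U ->
  perm_eq [seq permute s w | w <- dual_rep U] (dual_rep U).
Proof.
move=> pe; have := perm_map (fun w : {ffun I -> int} => - w) pe.
by rewrite -map_comp /dual_rep -map_comp (eq_map permuteN).
Qed.

Lemma act_grothB nu Q i :
  act g (grothB nu (repE e i) (repM e Q i)) = grothB nu (repE e i) (repM e Q i).
Proof.
rewrite /grothB act_mseries_sum; congr mseries_sum; apply/funext => -[la mu].
rewrite actMz (actM gK g'K) (act_grothU la (perm_repE i)).
by rewrite (act_grothU _ (perm_dual (perm_repM Q i))).
Qed.

Lemma act_prod_grothB (mu : 'I_n -> intpart) Q :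
  act g (\prod_(i < n) grothB (mu i) (repE e i) (repM e Q i)) =
  \prod_(i < n) grothB (mu i) (repE e i) (repM e Q i).
Proof. by rewrite (act_prod gK g'K); apply: eq_bigr => i _; exact: act_grothB. Qed.

Lemma act_rep_ring f : rep_ring f -> act g f = f.
Proof.
move=> [P symP <-]; rewrite /laurent_mseries act_sum.
have permK' : cancel (permute s) (permute s').
  by move=> w; apply/ffunP => k; rewrite !ffunE -/(g' k) /=; congr (w _); apply: g'K.
have permK'' : cancel (permute s') (permute s).
  by move=> w; apply/ffunP => k; rewrite !ffunE /=; congr (w _); apply: gK.
have pe : perm_eq [seq permute s w | w <- finsupp P] (finsupp P).
  apply: uniq_perm; rewrite ?fset_uniq //.
    by rewrite map_inj_uniq ?fset_uniq //; exact: can_inj permK'.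
  move=> w; apply/mapP/idP => [[v + ->]|wP].
    by rewrite !mem_finsupp symP.
  by exists (permute s' w); rewrite ?permK'' // mem_finsupp -(symP s) permK'' -mem_finsupp.
rewrite -[RHS](perm_big _ pe) big_map; apply: eq_bigr => w _.
by rewrite actMz act_weight_class symP.
Qed.

End TorusAction.

(** * Classes of lines *)

Section ClassLine.
Variable I : finType.

Lemma class_line_supp (k : I) m : class_line k m != 0 -> exists p, m = msetn p k.
Proof.
move=> nz; apply: contrapT => no; move/eqP: nz; apply; rewrite /class_line /mseries_sum.
apply: fsbig1 => p _; rewrite monomX; apply/eqP; apply: contraT => /monom_neq0 mE.
by case: no; exists p.
Qed.

Lemma class_line0 (k : I) : class_line k mset0 = 1.
Proof.
rewrite /class_line /mseries_sum (@fsum_seq _ _ _ [:: 0%N]) //.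
  by rewrite big_seq1 expr0 coef1 eqxx.
move=> p _; rewrite inE => p0; rewrite monomX; apply/eqP; apply: contraNT p0 => /monom_neq0.
by move=> /(congr1 (fun m : {mset I} => m k)); rewrite mset0E msetnxx => <-.
Qed.

Lemma weight_class_line (k : I) : weight_class (line k) = class_line k.
Proof.
rewrite /weight_class (bigD1 k) //= ffunE eqxx /= expr1 big1 ?mulr1 // => l lk.
by rewrite ffunE (negbTE lk) /= expr0.
Qed.

Lemma weight_class_lineN (k : I) : weight_class (- line k) = 1 - mvar k.
Proof.
rewrite /weight_class (bigD1 k) //= !ffunE eqxx /= expr1 big1 ?mulr1 // => l lk.
by rewrite !ffunE (negbTE lk) /= expr0.
Qed.

(** The constant term 1 of the class of a line cancels. *)
Lemma val_dual_line (w : I -> nat) k : val_ge w (w k) (1 - class_line k).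
Proof.
move=> m; have [->|m0] := eqVneq m mset0.
  by rewrite coefD coefN coef1 eqxx class_line0 subrr eqxx.
rewrite coefD coefN coef1 (negbTE m0) add0r oppr_eq0 => /class_line_supp[p mE].
have p0 : (0 < p)%N by rewrite lt0n; apply: contraNneq m0 => p0; rewrite mE p0 msetn0.
by rewrite mE wsum_msetn leq_pmull.
Qed.

End ClassLine.

(** * The expansion *)

Section Expansion.
Variables (n : nat) (Q : quiver n) (e : 'I_n -> nat).
Hypothesis acyclicQ : acyclic Q.
Local Notation I := (torus_coord e).
Local Notation coord i j := (Tagged (fun v => 'I_(e v)) (j : 'I_(e i)) : I).

(** A line of E_i has the height of i as its weight, so the lines that occur in
    M_i, which come from tails of arrows to i, weigh more than those of E_i. *)
Definition vertex_weight (k : I) : nat := height Q (tag k).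
Definition coord_index (k : I) : nat := tagged k.
Local Notation D := vertex_weight.
Local Notation E := coord_index.

Definition coord_mset (i : 'I_n) (k : nat) : {mset I} :=
  if insub k is Some j then [mset (coord i j)]%mset else mset0.

Let argsE i (k : nat) : mseries I := [seq 1 - weight_class (- w) | w <- repE e i]`_k.

Let argsE_mvar i (j : 'I_(e i)) : argsE i j = mvar (coord i j).
Proof.
rewrite /argsE /repE -map_comp (nth_map j) ?size_enum_ord // nth_ord_enum /=.
by rewrite weight_class_lineN opprB addrC subrK.
Qed.

Let argsE0 i k : (e i <= k)%N -> argsE i k = 0.
Proof. by move=> le; rewrite /argsE nth_default // size_map /repE size_map size_enum_ord. Qed.

Let argsE_monom i k : argsE i k = 0 \/
  [/\ argsE i k = monom (coord_mset i k), wsum D (coord_mset i k) = height Q i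
    & wsum E (coord_mset i k) = k].
Proof.
have [lt|ge] := ltnP k (e i); last by left; apply: argsE0.
right; rewrite (argsE_mvar (Ordinal lt)) /coord_mset insubT !wsum1; split=> //.
Qed.

Let argsE_neq0 i k : (k < e i)%N -> argsE i k != 0.
Proof.
move=> lt; rewrite (argsE_mvar (Ordinal lt)).
apply/eqP => /(congr1 (fun h : mseries I => h [mset (coord i (Ordinal lt))]%mset)).
by rewrite mvarE /monom eqxx.
Qed.

Lemma grothE_lead i (nu : intpart) : (size nu <= e i)%N ->
  lead D E (grothU nu (repE e i)) (groth_mon nu (coord_mset i)).
Proof.
move=> sz; apply: (@groth_lead _ nu (argsE i) (coord_mset i) D E (height Q i)).
- exact: height_gt0.
- exact: argsE_monom.
- by move=> k lt; apply: argsE_neq0; apply: leq_trans sz.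
Qed.

Lemma grothE_val i (nu : intpart) : val_ge D (height Q i * sumn nu) (grothU nu (repE e i)).
Proof.
apply: groth_val => k; rewrite -/(argsE i k); case: (argsE_monom i k) => [->|[-> <- _]].
  by move=> m; rewrite coef0 eqxx.
exact: val_ge_monom.
Qed.

Lemma grothM_val i (nu : intpart) :
  val_ge D ((height Q i).+1 * sumn nu) (grothU nu (dual_rep (repM e Q i))).
Proof.
apply: groth_val => k.
have [lt|ge] := ltnP k (size (dual_rep (repM e Q i))); last first.
  by move=> m; rewrite nth_default; [rewrite coef0 eqxx | rewrite size_map].
rewrite (nth_map 0) //; have := mem_nth 0 lt; set w := nth _ _ _.
rewrite /dual_rep => /mapP[w0 + ->]; rewrite opprK => /flatten_mapP[a].
rewrite mem_filter => /andP[/eqP <- _] /mapP[j _ ->].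
rewrite weight_class_line; apply: val_geW (@val_dual_line _ D _).
exact: height_arrow.
Qed.

Lemma wsum_groth_mon i (nu : intpart) : (size nu <= e i)%N ->
  wsum D (groth_mon nu (coord_mset i)) = (height Q i * sumn nu)%N.
Proof.
move=> sz; rewrite /groth_mon wsum_sum sumn_box big_distrr; apply: eq_bigr => b _ /=.
have lt : (box_row b < e i)%N by apply: leq_trans (box_row_lt b) sz.
by rewrite /coord_mset insubT wsum1 muln1.
Qed.

Lemma groth_part0 (J : choiceType) (a : nat -> mseries J) : groth (conj_part part0) a = 1.
Proof.
have -> : conj_part part0 = part0 by apply: val_inj.
rewrite (_ : groth part0 a = groth part0 (fun=> 0)).
  rewrite (@groth_tabsum _ _ 0) // tabsum0 (_ : _ == _ = true) //.
  by apply/eqP/setP => -[[]].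
rewrite !grothE; congr mseries_sum; apply/funext => T.
by rewrite /groth_term; congr (_ * _); apply: eq_bigr => -[[]].
Qed.

(** In the sum over pairs (la, mu) that defines grothB, terms with mu non-empty
    exceed the minimal weight because lines of M_i weigh more than those of E_i,
    terms with |la| > |nu| because of their degree, and the remaining terms vanish
    by groth_d_delta, except for la = nu, which gives the leading monomial. *)
Lemma grothB_lead i (nu : intpart) : (size nu <= e i)%N ->
  lead D E (grothB nu (repE e i) (repM e Q i)) (groth_mon nu (coord_mset i)).
Proof.
move=> sz; set m0 := groth_mon _ _.
pose term (p : intpart * intpart) : mseries I := grothU p.1 (repE e i) *
  grothU (conj_part p.2) (dual_rep (repM e Q i)) *~ groth_d nu p.1 p.2.
have term0 : term (nu, part0) = grothU nu (repE e i).
  by rewrite /term /= groth_d_delta // eqxx mulr1z /grothU groth_part0 mulr1.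
have [lead1 lead2] := grothE_lead sz.
have other p m : p != (nu, part0) -> term p m != 0 -> klt D E m0 m.
  case: p => la mu ne; rewrite /term /= coefMz mulf_eq0 negb_or => /andP[nz dnz].
  have := val_geM (@grothE_val i la) (@grothM_val i (conj_part mu)) nz.
  rewrite sumn_conj => le; have le2 := groth_d_small dnz.
  rewrite /klt (wsum_groth_mon sz); apply/orP; left; apply: leq_trans le.
  have h0 := height_gt0 Q i.
  have [mu0|mu0] := posnP (sumn mu); last first.
    by move: (height Q i) h0 => h h0; nia.
  have mu0E : mu = part0.
    apply: intpart_eq => k; rewrite [RHS]nth_nil; apply/eqP; rewrite -leqn0.
    suff : (nth 0 mu k <= sumn mu)%N by rewrite mu0.
    have [lt|ge] := ltnP k (size mu); last by rewrite nth_default.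
    by rewrite sumnE (big_rem _ (mem_nth 0%N lt)) /= leq_addr.
  rewrite mu0 addn0 in le2; rewrite mu0 muln0 addn0 ltn_pmul2l // ltn_neqAle le2 andbT.
  apply: contraNneq dnz => eqs; rewrite mu0E groth_d_delta //.
  by case: (la =P nu) => // e'; rewrite e' mu0E eqxx in ne.
split=> [|m nz].
  rewrite /grothB coef_mseries_sum (@fsum_seq _ _ _ [:: (nu, part0)]) //.
    by rewrite big_seq1 -/(term (nu, part0)) term0.
  move=> p _; rewrite inE -/(term p) => ne; apply/eqP; apply: contraT => /(other p _ ne).
  by rewrite /klt !ltnn andbF.
have [p pnz] : exists p, term p m != 0.
  apply: contrapT => no; move/eqP: nz; apply; rewrite /grothB coef_mseries_sum.
  apply: fsbig1 => p _; apply/eqP; apply: contraT => pnz; case: no; exists p; exact: pnz.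
have [pE|ne] := eqVneq p (nu, part0); last by right; apply: other pnz.
by apply: lead2; rewrite -term0 -pE.
Qed.

Definition parts_mon (mu : bounded_parts e) : {mset I} :=
  \big[msetD/mset0]_(i < n) groth_mon (val mu i) (coord_mset i).

Lemma bounded_size (mu : bounded_parts e) i : (size (val mu i) <= e i)%N.
Proof. by have /forallP := valP mu; apply. Qed.

Lemma parts_lead (mu : bounded_parts e) :
  lead D E (\prod_(i < n) grothB (val mu i) (repE e i) (repM e Q i)) (parts_mon mu).
Proof. by apply: lead_prod => i; apply: grothB_lead; exact: bounded_size. Qed.

Lemma parts_monE (mu : bounded_parts e) (i : 'I_n) (j : 'I_(e i)) :
  parts_mon mu (coord i j) = nth 0%N (val mu i) j.
Proof.
rewrite /parts_mon mset_bigE (bigD1 i) //= [X in (_ + X)%N]big1 ?addn0 => [|i' ne]; last first.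
  rewrite /groth_mon mset_bigE big1 // => b _; rewrite /coord_mset.
  case: insubP => [j' _ _|_]; last by rewrite mset0E.
  rewrite msetnE; case: eqP => // /(congr1 tag) /= e'; by rewrite e' eqxx in ne.
rewrite /groth_mon mset_bigE (eq_bigr (fun b : box (val mu i) => nat_of_bool (box_row b == j))); last first.
  move=> b _; have lt : (box_row b < e i)%N by apply: leq_trans (box_row_lt b) (bounded_size mu i).
  by rewrite /coord_mset insubT msetnE eq_Tagged /= eq_sym -val_eqE /=; case: eqP.
rewrite (sum_box (val mu i) (fun r => nat_of_bool (r == j))).
have [lt|ge] := ltnP j (size (val mu i)); last first.
  rewrite nth_default // big1 // => r _; rewrite ltn_eqF ?muln0 //; exact: leq_trans (ltn_ord r) ge.
rewrite (bigD1 (Ordinal lt)) //= eqxx muln1 big1 ?addn0 // => r.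
by rewrite -val_eqE /= => /negbTE ->; rewrite muln0.
Qed.

Lemma parts_mon_inj : injective parts_mon.
Proof.
move=> mu nu eqm; apply/val_inj/ffunP => i; apply: intpart_eq => k.
have [lt|ge] := ltnP k (e i).
  by have := congr1 (fun m : {mset I} => m (coord i (Ordinal lt))) eqm; rewrite /= !parts_monE.
by rewrite !nth_default // (leq_trans (bounded_size _ i)).
Qed.

Definition torus_sim (m m' : {mset I}) : Prop :=
  exists s : forall i, 'S_(e i), m' = relabel (coord_perm s) m.

Lemma torus_sim_parts m : exists mu, torus_sim m (parts_mon mu).
Proof.
have H : forall i : 'I_n, exists p : 'S_(e i) * intpart,
    (size p.2 <= e i)%N /\ forall j : 'I_(e i), nth 0%N p.2 j = m (coord i (p.1 j)).
  move=> i; have [s [la [sz laE]]] := sort_exponents (fun j : 'I_(e i) => m (coord i j)).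
  by exists (s, la).
pose ps i := sval (cid (H i)); have psP i := svalP (cid (H i) : {p | _}); rewrite -/(ps _) in psP.
have bnd : [forall i, (size ([ffun i => (ps i).2] i) <= e i)%N].
  by apply/forallP => i; rewrite ffunE; have [] := psP i.
pose mu : bounded_parts e := exist _ [ffun i => (ps i).2] bnd.
have muE i : val mu i = (ps i).2 by rewrite /= ffunE.
pose s i := (ps i).1; pose s' i := ((s i)^-1)%g.
exists mu, s'; apply/msetP => -[i j].
have sK : cancel (coord_perm s) (coord_perm s') by apply: coord_permK => v; exact: permK.
have s'K : cancel (coord_perm s') (coord_perm s) by apply: coord_permK => v; exact: permKV.
have := relabelE m (coord_perm s (existT _ i j)) (can_inj s'K); rewrite sK => ->.
by rewrite (parts_monE mu j) muE; have [_ ->] := psP i.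
Qed.

Definition Rparts (mu nu : bounded_parts e) : Prop := klt D E (parts_mon mu) (parts_mon nu).

Lemma sumn_le_parts (mu : bounded_parts e) i : (sumn (val mu i) <= wsum D (parts_mon mu))%N.
Proof.
rewrite /parts_mon wsum_sum (bigD1 i) //=; apply: leq_trans (leq_addr _ _).
by rewrite (wsum_groth_mon (bounded_size mu i)) leq_pmull // height_gt0.
Qed.

Lemma Rparts_fin nu : finite_set [set mu | Rparts mu nu].
Proof.
pose d := wsum D (parts_mon nu).
pose A := fset_set [set la : intpart | (sumn la <= d)%N].
have memA la : (la \in A) = (sumn la <= d)%N.
  rewrite /A in_fset_set; last exact: finite_intparts.
  by apply/idP/idP; rewrite inE.
have bnd0 : [forall i : 'I_n, (size ([ffun=> part0] i : intpart) <= e i)%N].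
  by apply/forallP => i; rewrite ffunE.
pose mu0 : bounded_parts e := exist _ [ffun=> part0] bnd0.
pose F (g : {ffun 'I_n -> A}) : bounded_parts e := insubd mu0 [ffun i => val (g i)].
apply: (@sub_finite_set _ _ (F @` setT)); last exact/finite_image/finite_finset.
move=> mu /= Rmu.
have inA i : val mu i \in A.
  rewrite memA; apply: leq_trans (sumn_le_parts mu i) _.
  by move: Rmu; rewrite /Rparts /klt /d; lia.
exists [ffun i => [` inA i]%fset] => //; apply: val_inj.
have E1 : [ffun i => val ([ffun i => [` inA i]%fset] i)] = val mu.
  by apply/ffunP => i; rewrite !ffunE.
by rewrite /F E1 valKd.
Qed.

Lemma torus_expansion (f : mseries I) : rep_ring f ->
  exists! c : bounded_parts e -> int,
    sums_to [set: bounded_parts e]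
      (fun mu => (\prod_(i < n) grothB (val mu i) (repE e i) (repM e Q i)) *~ c mu) f.
Proof.
move=> frep; apply: (@triangular_expansion _ _ torus_sim parts_mon _ Rparts).
- exact: wf_klt.
- exact: Rparts_fin.
- by move=> mu; have [] := parts_lead mu.
- by move=> mu nu /(proj2 (parts_lead mu))[/parts_mon_inj|]; [left|right].
- exact: torus_sim_parts.
- move=> mu m _ [s ->].
  rewrite -[RHS]/(act (coord_perm s) (\prod_(i < n) grothB (val mu i) (repE e i) (repM e Q i)) m).
  rewrite act_prod_grothB //.
- by move=> m _ [s ->]; rewrite -[RHS]/(act (coord_perm s) f m) act_rep_ring.
Qed.
End Expansion.

Theorem proposition3p1 (n : nat) (Q : quiver n) (e : 'I_n -> nat)
    (acyclicQ : acyclic Q) (f : mseries (torus_coord e)) (f_rep : rep_ring f) :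
  exists! c : bounded_parts e -> int,
    sums_to [set: bounded_parts e]
      (fun mu => (\prod_(i < n) grothB (val mu i) (repE e i) (repM e Q i)) *~ c mu)
      f.
Proof. exact: torus_expansion. Qed.
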